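(* Let $A \subseteq \omega$ be infinite and suppose there is a single relative c.e. operator $\Theta$ such that $\Theta(S) = A$ for every infinite $S \subseteq A$. Then there is an infinite $B \subseteq A$ and a single Turing functional $\Phi$ such that $\Phi(S) = B$ for every infinite $S \subseteq B$.
   Context: A relative c.e. operator is a c.e. set $\Theta$ of pairs $(\sigma, x) \in 2^{<\omega}\times\omega$; for $X\subseteq\omega$, $\Theta(X)$ is the set of $x$ for which some initial segment $\sigma$ of the characteristic function of $X$ has $(\sigma,x)\in\Theta$. $\Phi(S)$ denotes the set computed by Turing functional $\Phi$ with oracle $S$. *)

(* Defs.v *)
From Stdlib Require Import List Arith.
Import ListNotations.

(** Oracle mu-recursive programs. Arguments are passed as a list of naturals;
    missing arguments default to 0 (a computable convention). *)
Inductive prog : Type :=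
| PZero : prog
| PSucc : prog
| PProj : nat -> prog
| POrac : prog
| PComp : prog -> list prog -> prog
| PPrim : prog -> prog -> prog
| PMu   : prog -> prog.

Inductive eval (X : nat -> bool) : prog -> list nat -> nat -> Prop :=
| eZero args : eval X PZero args 0
| eSucc args : eval X PSucc args (S (hd 0 args))
| eProj i args : eval X (PProj i) args (nth i args 0)
| eOrac args : eval X POrac args (if X (hd 0 args) then 1 else 0)
| eComp f gs args ys y :
    evals X gs args ys -> eval X f ys y -> eval X (PComp f gs) args y
| ePrim0 f g rest y :
    eval X f rest y -> eval X (PPrim f g) (0 :: rest) y
| ePrimS f g n rest r y :
    eval X (PPrim f g) (n :: rest) r ->
    eval X g (n :: r :: rest) y ->
    eval X (PPrim f g) (S n :: rest) y
| eMu f args y :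
    eval X f (y :: args) 0 ->
    (forall z, z < y -> exists v, eval X f (z :: args) (S v)) ->
    eval X (PMu f) args y
with evals (X : nat -> bool) : list prog -> list nat -> list nat -> Prop :=
| esNil args : evals X [] args []
| esCons g gs args y ys :
    eval X g args y -> evals X gs args ys -> evals X (g :: gs) args (y :: ys).

(** Computable bijective coding of binary strings (2^{<omega}) by naturals. *)
Fixpoint code (s : list bool) : nat :=
  match s with
  | [] => 0
  | b :: s' => 2 * code s' + (if b then 2 else 1)
  end.

Definition infinite (S : nat -> bool) : Prop :=
  forall n, exists m, n <= m /\ S m = true.

Definition subset (S A : nat -> bool) : Prop :=
  forall n, S n = true -> A n = true.

(** A relative c.e. operator: a c.e. set of pairs (sigma, x) in 2^{<omega} x omega.
    c.e. = domain of a (non-oracle) partial computable function, i.e. of a program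
    run with the empty oracle. *)
Definition ce_pairs (Theta : list bool -> nat -> Prop) : Prop :=
  exists p : prog, forall sigma x,
    Theta sigma x <-> exists y, eval (fun _ => false) p [code sigma; x] y.

Definition is_prefix (sigma : list bool) (X : nat -> bool) : Prop :=
  forall i, i < length sigma -> nth i sigma false = X i.

Definition apply_op (Theta : list bool -> nat -> Prop) (X : nat -> bool) (x : nat) : Prop :=
  exists sigma, is_prefix sigma X /\ Theta sigma x.

Definition computes (Phi : prog) (S B : nat -> bool) : Prop :=
  forall n, eval S Phi [n] (if B n then 1 else 0).

(* Main.v *)
Require Import Defs.
From Stdlib Require Import List Arith Lia Bool.
From Stdlib Require Import Classical ClassicalEpsilon FunctionalExtensionality.
Import ListNotations.

(** Let [E_j(Y)] be the finite part of [Theta(Y)] enumerated by stage [j]. A clopen Ramsey theorem,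
    applied to the question whether [a] is enumerated by [S] no later than [b] (for
    [a < b < min S]), gives an infinite [A0] inside [A] and a pivot: for [c] in [A0] and [Y]
    inside [A0] above [c] with least element [s], [c] is enumerated by [Y] minus [s] no later
    than [piv s] is, where [piv s] is [s] if the answer is always yes, and the constant [min A0]
    if it is always no (then [A0] loses its minimum). Waiting for the pivot makes "[c] is
    enumerated in time" ([accepted]) decidable from [Y], and it implies that [c] is in [A].

    [selected] is the greedy process that adds [e] to the part [F] selected so far when [e] is
    accepted and when, for [b] in [F] and [G] a subset of [F] above [b], the process run on
    the union of [G], [e] and [Y] instead of [Y] still selects [F] up to [b]. Deciding
    [m = 0, 1, 2, ...] in turn, each time shrinking a reservoir on which the colour
    "[m] is selected" is constant, produces [B]. The consistency clause makes the selected part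
    robust under the later members of [B], although these need not lie in the earlier reservoirs;
    conversely every element of a reservoir passes the test, so [B] is infinite. Hence, for [S]
    inside [B] and [s] in [S], the process run on [S] above [s] computes [B] up to [s]. *)

(** * Computable functionals *)

(** One program serves every oracle and halts on every list of length [k], so these are total
    functionals. The arity is recorded because [PPrim] has no value on the empty list. *)
Definition computable (k : nat) (f : (nat -> bool) -> list nat -> nat) : Prop :=
  exists p, forall X l, length l = k -> eval X p l (f X l).

Lemma computable_ext k f g :
  (forall X l, length l = k -> f X l = g X l) -> computable k f -> computable k g.
Proof. intros H [p Hp]. exists p. intros X l Hl. rewrite <- H by easy. now apply Hp. Qed.

Lemma computable_nth k i : computable k (fun X l => nth i l 0).
Proof. exists (PProj i). intros. constructor. Qed.

(** Recursion and bounded operators push their variables onto the front of the list, so outer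
    variables occur below iterated [tl]. *)
Lemma computable_nth_tl k i (g : list nat -> list nat) :
  computable k (fun X l => nth (S i) (g l) 0) -> computable k (fun X l => nth i (tl (g l)) 0).
Proof.
  apply computable_ext. intros X l _. destruct (g l); simpl; [now destruct i|easy].
Qed.

Definition computable_list (k m : nat) (L : (nat -> bool) -> list nat -> list nat) : Prop :=
  exists ps, forall X l, length l = k -> evals X ps l (L X l) /\ length (L X l) = m.

Lemma computable_list_nil k : computable_list k 0 (fun X l => []).
Proof. exists []. split; [constructor|easy]. Qed.

Lemma computable_list_cons k m a L :
  computable k a -> computable_list k m L ->
  computable_list k (S m) (fun X l => a X l :: L X l).
Proof.
  intros [p Hp] [ps Hps]. exists (p :: ps). intros X l Hl. destruct (Hps X l Hl) as [H <-].
  split; [constructor; auto|easy].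
Qed.

Lemma computable_list_tl k m L :
  computable_list k (S m) L -> computable_list k m (fun X l => tl (L X l)).
Proof.
  intros [ps Hps]. exists (tl ps). intros X l Hl. destruct (Hps X l Hl) as [H1 H2].
  destruct H1; simpl in *; [easy|]. split; [assumption|lia].
Qed.

Lemma evals_proj X l0 l : evals X (map PProj (seq (length l0) (length l))) (l0 ++ l) l.
Proof.
  revert l0. induction l as [|x l IH]; intros l0; simpl; constructor.
  - replace x with (nth (length l0) (l0 ++ x :: l) 0) at 2 by apply nth_middle. constructor.
  - specialize (IH (l0 ++ [x])). rewrite length_app, Nat.add_1_r, <- app_assoc in IH. exact IH.
Qed.

Lemma computable_list_id k : computable_list k k (fun X l => l).
Proof.
  exists (map PProj (seq 0 k)). intros X l <-. split; [apply (evals_proj X [])|easy].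
Qed.

Lemma computable_comp k m f L :
  computable m f -> computable_list k m L -> computable k (fun X l => f X (L X l)).
Proof.
  intros [p Hp] [ps Hps]. exists (PComp p ps). intros X l Hl. destruct (Hps X l Hl).
  econstructor; eauto.
Qed.

Ltac comp_list :=
  repeat first [assumption | apply computable_list_nil | apply computable_list_cons
    | apply computable_list_tl | apply computable_list_id
    | (repeat apply computable_nth_tl); apply computable_nth].

Lemma computable_comp1 k f a :
  computable 1 (fun X l => f (nth 0 l 0)) -> computable k a -> computable k (fun X l => f (a X l)).
Proof. intros Hf Ha. apply (computable_comp k 1 _ (fun X l => [a X l]) Hf). comp_list. Qed.

Lemma computable_comp2 k f a b :
  computable 2 (fun X l => f (nth 0 l 0) (nth 1 l 0)) -> computable k a -> computable k b ->
  computable k (fun X l => f (a X l) (b X l)).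
Proof. intros Hf Ha Hb. apply (computable_comp k 2 _ (fun X l => [a X l; b X l]) Hf). comp_list. Qed.

Lemma computable_comp3 k f a b c :
  computable 3 (fun X l => f (nth 0 l 0) (nth 1 l 0) (nth 2 l 0)) ->
  computable k a -> computable k b -> computable k c ->
  computable k (fun X l => f (a X l) (b X l) (c X l)).
Proof.
  intros Hf Ha Hb Hc. apply (computable_comp k 3 _ (fun X l => [a X l; b X l; c X l]) Hf).
  comp_list.
Qed.

Lemma computable_comp4 k f a b c d :
  computable 4 (fun X l => f (nth 0 l 0) (nth 1 l 0) (nth 2 l 0) (nth 3 l 0)) ->
  computable k a -> computable k b -> computable k c -> computable k d ->
  computable k (fun X l => f (a X l) (b X l) (c X l) (d X l)).
Proof.
  intros Hf Ha Hb Hc Hd.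
  apply (computable_comp k 4 _ (fun X l => [a X l; b X l; c X l; d X l]) Hf). comp_list.
Qed.

Lemma computable_S k a : computable k a -> computable k (fun X l => S (a X l)).
Proof.
  apply computable_comp1. exists PSucc. intros X [|x l] Hl; [easy|]. apply (eSucc X (x :: l)).
Qed.

Lemma computable_const k c : computable k (fun X l => c).
Proof.
  induction c as [|c IH]; [exists PZero; intros; constructor|]. now apply computable_S.
Qed.

Lemma computable_oracle k a :
  computable k a -> computable k (fun X l => Nat.b2n (X (a X l))).
Proof.
  intros Ha.
  apply (computable_comp k 1 (fun X l => Nat.b2n (X (nth 0 l 0))) (fun X l => [a X l])); [|comp_list].
  exists POrac. intros X [|x l] Hl; [easy|].
  apply (eOrac X (x :: l)).
Qed.

Lemma computable_rec k f g h :
  computable k f -> computable (S (S k)) (fun X l => g (nth 0 l 0) (nth 1 l 0) X (tl (tl l))) ->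
  computable k h ->
  computable k (fun X l => nat_rect (fun _ => nat) (f X l) (fun n r => g n r X l) (h X l)).
Proof.
  intros [pf Hf] [pg Hg] [ph Hh].
  exists (PComp (PPrim pf pg) (ph :: map PProj (seq 0 k))). intros X l Hl.
  econstructor.
  - constructor; [now apply Hh|]. rewrite <- Hl. apply (evals_proj X []).
  - induction (h X l) as [|n IH]; simpl; econstructor; eauto.
    specialize (Hg X (n :: nat_rect (fun _ => nat) (f X l) (fun n r => g n r X l) n :: l)).
    simpl in Hg. apply Hg. now rewrite Hl.
Qed.

(** In the recursion behind a bounded operator the list is [i :: r :: l], while the body depends on
    [i :: l]; the accumulator [r] has to be skipped. *)
Lemma computable_bound k f :
  computable (S k) (fun X l => f X (tl l) (nth 0 l 0)) ->
  computable (S (S k)) (fun X l => f X (tl (tl l)) (nth 0 l 0)).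
Proof.
  intros Hf. apply (computable_comp _ _ _ (fun X l => nth 0 l 0 :: tl (tl l)) Hf). comp_list.
Qed.

(** * Bounded operators, binary arithmetic and Boolean tests *)

Definition cond (c x y : nat) : nat := match c with 0 => y | S _ => x end.

Definition bsum (n : nat) (f : nat -> nat) : nat :=
  nat_rect (fun _ => nat) 0 (fun i r => r + f i) n.

Definition bmax (n : nat) (f : nat -> nat) : nat :=
  nat_rect (fun _ => nat) 0 (fun i r => Nat.max r (f i)) n.

Ltac comp_var := repeat apply computable_nth_tl; apply computable_nth.

Lemma computable_add k a b :
  computable k a -> computable k b -> computable k (fun X l => a X l + b X l).
Proof.
  apply (computable_comp2 k Nat.add).
  apply computable_ext with (f := fun X l =>
    nat_rect (fun _ => nat) (nth 0 l 0) (fun n r => S r) (nth 1 l 0)).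
  - intros X l _. induction (nth 1 l 0); simpl; lia.
  - apply computable_rec; [comp_var|apply computable_S; comp_var|comp_var].
Qed.

Lemma computable_pred k a : computable k a -> computable k (fun X l => pred (a X l)).
Proof.
  apply (computable_comp1 k pred).
  apply computable_ext with (f := fun X l =>
    nat_rect (fun _ => nat) 0 (fun n r => n) (nth 0 l 0)).
  - intros X l _. now destruct (nth 0 l 0).
  - apply computable_rec; [apply computable_const|comp_var|comp_var].
Qed.

Lemma computable_sub k a b :
  computable k a -> computable k b -> computable k (fun X l => a X l - b X l).
Proof.
  apply (computable_comp2 k Nat.sub).
  apply computable_ext with (f := fun X l =>
    nat_rect (fun _ => nat) (nth 0 l 0) (fun n r => pred r) (nth 1 l 0)).
  - intros X l _. induction (nth 1 l 0); simpl; lia.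
  - apply computable_rec; [comp_var|apply computable_pred; comp_var|comp_var].
Qed.

Lemma computable_max k a b :
  computable k a -> computable k b -> computable k (fun X l => Nat.max (a X l) (b X l)).
Proof.
  intros Ha Hb. apply computable_ext with (f := fun X l => a X l + (b X l - a X l)).
  - intros X l _. lia.
  - apply computable_add; [|apply computable_sub]; assumption.
Qed.

Lemma computable_mul k a b :
  computable k a -> computable k b -> computable k (fun X l => a X l * b X l).
Proof.
  apply (computable_comp2 k Nat.mul).
  apply computable_ext with (f := fun X l =>
    nat_rect (fun _ => nat) 0 (fun n r => r + nth 0 l 0) (nth 1 l 0)).
  - intros X l _. induction (nth 1 l 0); simpl; lia.
  - apply computable_rec; [apply computable_const|apply computable_add; comp_var|comp_var].
Qed.

Lemma computable_pow2 k a : computable k a -> computable k (fun X l => 2 ^ a X l).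
Proof.
  apply (computable_comp1 k (Nat.pow 2)).
  apply computable_ext with (f := fun X l =>
    nat_rect (fun _ => nat) 1 (fun n r => r + r) (nth 0 l 0)).
  - intros X l _. induction (nth 0 l 0); simpl; lia.
  - apply computable_rec; [apply computable_const|apply computable_add; comp_var|comp_var].
Qed.

Lemma computable_cond k a b c :
  computable k a -> computable k b -> computable k c ->
  computable k (fun X l => cond (a X l) (b X l) (c X l)).
Proof.
  apply (computable_comp3 k cond).
  apply computable_ext with (f := fun X l =>
    nat_rect (fun _ => nat) (nth 2 l 0) (fun n r => nth 1 l 0) (nth 0 l 0)).
  - intros X l _. now destruct (nth 0 l 0).
  - apply computable_rec; comp_var.
Qed.

Lemma computable_bsum k n f :
  computable k n -> computable (S k) (fun X l => f X (tl l) (nth 0 l 0)) ->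
  computable k (fun X l => bsum (n X l) (f X l)).
Proof.
  intros Hn Hf.
  apply (computable_rec k (fun _ _ => 0) (fun i r X l => r + f X l i)); auto.
  - apply computable_const.
  - apply computable_add; [comp_var|]. now apply computable_bound.
Qed.

Lemma computable_bmax k n f :
  computable k n -> computable (S k) (fun X l => f X (tl l) (nth 0 l 0)) ->
  computable k (fun X l => bmax (n X l) (f X l)).
Proof.
  intros Hn Hf.
  apply (computable_rec k (fun _ _ => 0) (fun i r X l => Nat.max r (f X l i))); auto.
  - apply computable_const.
  - apply computable_max; [comp_var|]. now apply computable_bound.
Qed.

Lemma computable_div_pow2 k a b :
  computable k a -> computable k b -> computable k (fun X l => a X l / 2 ^ b X l).
Proof.
  apply (computable_comp2 k (fun a b => a / 2 ^ b)).
  apply computable_ext with (f := fun X l =>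
    nat_rect (fun _ => nat) (nth 0 l 0) (fun n r => Nat.div2 r) (nth 1 l 0)).
  - intros X l _. rewrite <- Nat.shiftr_div_pow2. reflexivity.
  - apply computable_rec; try comp_var.
    apply (computable_comp1 4 Nat.div2); [|comp_var].
    (* The recursion is [div2 (S n) = n - div2 n]: the rounded halves of [n] and [S n] add up to
       [n]. *)
    apply computable_ext with (f := fun X l =>
      nat_rect (fun _ => nat) 0 (fun n r => n - r) (nth 0 l 0)).
    + intros X l _. induction (nth 0 l 0) as [|n IH]; [easy|]. simpl nat_rect. rewrite IH.
      change (n - Nat.div2 n = Nat.div2 (S n)).
      enough (Nat.div2 n + Nat.div2 (S n) = n) by (now apply Nat.add_sub_eq_l).
      clear.
      induction n as [|n IHn]; [easy|]. change (Nat.div2 (S (S n))) with (S (Nat.div2 n)). lia.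
    + apply computable_rec; [apply computable_const|apply computable_sub; comp_var|comp_var].
Qed.

Lemma computable_mod_pow2 k a b :
  computable k a -> computable k b -> computable k (fun X l => a X l mod 2 ^ b X l).
Proof.
  intros Ha Hb.
  apply computable_ext with (f := fun X l => a X l - 2 ^ b X l * (a X l / 2 ^ b X l)).
  - intros X l _. symmetry. apply Nat.Div0.mod_eq.
  - apply computable_sub; [assumption|].
    apply computable_mul; [now apply computable_pow2|now apply computable_div_pow2].
Qed.

Lemma b2n_testbit a i : Nat.b2n (Nat.testbit a i) = a / 2 ^ i - 2 * (a / 2 ^ S i).
Proof.
  rewrite Nat.testbit_spec', Nat.pow_succ_r', (Nat.mul_comm 2 (2 ^ i)), <- Nat.Div0.div_div.
  apply Nat.Div0.mod_eq.
Qed.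

Lemma computable_testbit k a b :
  computable k a -> computable k b ->
  computable k (fun X l => Nat.b2n (Nat.testbit (a X l) (b X l))).
Proof.
  intros Ha Hb.
  apply computable_ext with (f := fun X l => a X l / 2 ^ b X l - 2 * (a X l / 2 ^ S (b X l))).
  - intros X l _. symmetry. apply b2n_testbit.
  - repeat first [apply computable_sub|apply computable_mul|apply computable_div_pow2
      |apply (computable_S k b)|assumption|apply computable_const].
Qed.

Lemma computable_ltb k a b :
  computable k a -> computable k b ->
  computable k (fun X l => Nat.b2n (a X l <? b X l)).
Proof.
  intros Ha Hb.
  apply computable_ext with (f := fun X l => 1 - (S (a X l) - b X l)).
  - intros X l _. destruct (Nat.ltb_spec (a X l) (b X l)); cbn [Nat.b2n]; lia.
  - repeat first [apply computable_sub|apply (computable_S k a)|assumption|apply computable_const].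
Qed.

Lemma computable_eqb k a b :
  computable k a -> computable k b ->
  computable k (fun X l => Nat.b2n (a X l =? b X l)).
Proof.
  intros Ha Hb.
  apply computable_ext with (f := fun X l => 1 - ((a X l - b X l) + (b X l - a X l))).
  - intros X l _. destruct (Nat.eqb_spec (a X l) (b X l)); cbn [Nat.b2n]; lia.
  - repeat first [apply computable_sub|apply computable_add|assumption|apply computable_const].
Qed.

Lemma computable_andb k a b :
  computable k (fun X l => Nat.b2n (a X l)) -> computable k (fun X l => Nat.b2n (b X l)) ->
  computable k (fun X l => Nat.b2n (a X l && b X l)).
Proof.
  intros Ha Hb.
  apply computable_ext with (f := fun X l => Nat.b2n (a X l) * Nat.b2n (b X l)).
  - intros X l _. now destruct (a X l), (b X l).
  - now apply computable_mul.
Qed.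

Lemma computable_orb k a b :
  computable k (fun X l => Nat.b2n (a X l)) -> computable k (fun X l => Nat.b2n (b X l)) ->
  computable k (fun X l => Nat.b2n (a X l || b X l)).
Proof.
  intros Ha Hb.
  apply computable_ext with (f := fun X l => 1 - ((1 - Nat.b2n (a X l)) - Nat.b2n (b X l))).
  - intros X l _. now destruct (a X l), (b X l).
  - repeat first [apply computable_sub|assumption|apply computable_const].
Qed.

Lemma computable_if k b x y :
  computable k (fun X l => Nat.b2n (b X l)) -> computable k x -> computable k y ->
  computable k (fun X l => if b X l then x X l else y X l).
Proof.
  intros Hb Hx Hy.
  apply computable_ext with (f := fun X l => cond (Nat.b2n (b X l)) (x X l) (y X l)).
  - intros X l _. now destruct (b X l).
  - now apply computable_cond.
Qed.

Ltac comp_step :=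
  lazymatch goal with
  | |- computable _ (fun _ _ => nth _ _ _) => comp_var
  | |- computable _ (fun _ _ => _ + _) => apply computable_add
  | |- computable _ (fun _ _ => _ - _) => apply computable_sub
  | |- computable _ (fun _ _ => _ * _) => apply computable_mul
  | |- computable _ (fun _ _ => Nat.max _ _) => apply computable_max
  | |- computable _ (fun _ _ => 2 ^ _) => apply computable_pow2
  | |- computable _ (fun _ _ => _ / 2 ^ _) => apply computable_div_pow2
  | |- computable _ (fun _ _ => _ mod 2 ^ _) => apply computable_mod_pow2
  | |- computable _ (fun _ _ => pred _) => apply computable_pred
  | |- computable _ (fun _ _ => S _) => apply computable_S
  | |- computable _ (fun _ _ => bsum _ _) => apply computable_bsum
  | |- computable _ (fun _ _ => bmax _ _) => apply computable_bmax
  | |- computable _ (fun _ _ => if _ then _ else _) => apply computable_if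
  | |- computable _ (fun _ _ => Nat.b2n (Nat.testbit _ _)) => apply computable_testbit
  | |- computable _ (fun _ _ => Nat.b2n (_ <? _)) => apply computable_ltb
  | |- computable _ (fun _ _ => Nat.b2n (_ =? _)) => apply computable_eqb
  | |- computable _ (fun _ _ => Nat.b2n (_ && _)) => apply computable_andb
  | |- computable _ (fun _ _ => Nat.b2n (_ || _)) => apply computable_orb
  end.

Ltac comp := repeat first [assumption | apply computable_const | comp_step].

(** * Step-bounded evaluation *)

(** The programs in the list of [PComp] need induction hypotheses as well, which [Forall]
    provides. *)
Lemma prog_nested_ind (P : prog -> Prop) :
  P PZero -> P PSucc -> (forall i, P (PProj i)) -> P POrac ->
  (forall f gs, P f -> Forall P gs -> P (PComp f gs)) ->
  (forall f g, P f -> P g -> P (PPrim f g)) ->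
  (forall f, P f -> P (PMu f)) -> forall p, P p.
Proof.
  intros HZ HS Hp HO HC HR HM.
  fix IH 1. intros [| |i| |f gs|f g|f].
  - exact HZ.
  - exact HS.
  - apply Hp.
  - exact HO.
  - apply HC; [apply IH|]. induction gs; constructor; [apply IH|assumption].
  - apply HR; apply IH.
  - apply HM, IH.
Qed.

(** [bounded_eval t p l] is [S y] when [p] halts on [l] with output [y] and all its unbounded
    searches succeed below [t], and [0] otherwise. The oracle is empty. In the search, the
    accumulator is [0] while searching, [1] after a divergent call, [S (S y)] once [y] is found. *)
Fixpoint bounded_eval (t : nat) (p : prog) (l : list nat) : nat :=
  match p with
  | PZero => 1
  | PSucc => S (S (nth 0 l 0))
  | PProj i => S (nth i l 0)
  | POrac => 1
  | PComp f gs =>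
      let vs := map (fun g => bounded_eval t g l) gs in
      if forallb (fun v => 0 <? v) vs then bounded_eval t f (map pred vs) else 0
  | PPrim f g =>
      match l with
      | [] => 0
      | n :: rest =>
          nat_rect (fun _ => nat) (bounded_eval t f rest)
            (fun m r => if 0 <? r then bounded_eval t g (m :: pred r :: rest) else 0) n
      end
  | PMu f =>
      pred (nat_rect (fun _ => nat) 0
        (fun i r => if 0 <? r then r
                    else let v := bounded_eval t f (i :: l) in
                         if v =? 0 then 1 else if v =? 1 then S (S i) else 0) t)
  end.

(** Induction on the fixed program [p]: each constructor is imitated by a primitive recursive scheme
    in [t] and the arguments, so no coding of programs is involved. *)
Lemma computable_bounded_eval p k :
  computable (S k) (fun X l => bounded_eval (nth 0 l 0) p (tl l)).
Proof.
  revert k. induction p as [| |i| |f gs IHf IHgs|f g IHf IHg|f IHf] using prog_nested_ind;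
    intros k; simpl.
  - comp.
  - comp.
  - comp.
  - comp.
  - apply computable_if; [|
      |comp].
    + clear IHf. induction IHgs as [|g gs Hg _ IH]; simpl; [apply (computable_const _ 1)|].
      apply computable_andb; [|exact IH]. apply computable_ltb; [comp|apply Hg].
    + apply (computable_comp _ (S (length gs)) _
        (fun X l => nth 0 l 0 :: map pred (map (fun g => bounded_eval (nth 0 l 0) g (tl l)) gs))
        (IHf (length gs))).
      apply computable_list_cons; [comp|].
      clear IHf. induction IHgs as [|g gs Hg _ IH]; simpl; [apply computable_list_nil|].
      apply computable_list_cons; [apply computable_pred, Hg|exact IH].
  - destruct k as [|k].
    { apply computable_ext with (f := fun _ _ => 0); [|comp].
      intros X [|x [|y l]] Hl; easy. }
    apply computable_ext with (f := fun X l =>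
      nat_rect (fun _ => nat) (bounded_eval (nth 0 l 0) f (tl (tl l)))
        (fun m r => if 0 <? r
           then bounded_eval (nth 0 l 0) g (m :: pred r :: (tl (tl l))) else 0) (nth 1 l 0)).
    { now intros X [|x [|y l]] Hl. }
    apply (computable_rec (S (S k)) _ (fun m r X l => if 0 <? r
           then bounded_eval (nth 0 l 0) g (m :: pred r :: (tl (tl l))) else 0));
      [|apply computable_if|]; try solve [comp].
    + apply (computable_comp _ _ _ (fun X l => nth 0 l 0 :: tl (tl l)) (IHf k)). comp_list.
    + apply (computable_comp _ _ _ (fun X l => nth 0 (tl (tl l)) 0 :: nth 0 l 0 ::
        pred (nth 1 l 0) :: tl (tl (tl (tl l)))) (IHg (S (S k)))); comp_list.
      apply computable_pred. comp.
  - apply computable_pred.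
    apply (computable_rec (S k) _ (fun i r X l => if 0 <? r then r
                    else let v := bounded_eval (nth 0 l 0) f (i :: tl l) in
                         if v =? 0 then 1 else if v =? 1 then S (S i) else 0)); try solve [comp].
    assert (computable (S (S (S k))) (fun X l =>
      bounded_eval (nth 2 l 0) f (nth 0 l 0 :: tl (tl (tl l))))) as H.
    { apply (computable_comp _ _ _ (fun X l => nth 2 l 0 :: nth 0 l 0 ::
        tl (tl (tl l))) (IHf (S k))). comp_list. }
    cbv zeta.
    apply computable_ext with (f := fun X l => if 0 <? nth 1 l 0 then nth 1 l 0
                    else let v := bounded_eval (nth 2 l 0) f (nth 0 l 0 :: tl (tl (tl l))) in
                         if v =? 0 then 1 else if v =? 1 then S (S (nth 0 l 0)) else 0).
    { now intros X [|x [|y [|z l]]] Hl. }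
    cbv zeta. comp.
Qed.

Lemma bounded_eval_sound t p l y :
  bounded_eval t p l = S y -> eval (fun _ => false) p l y.
Proof.
  revert l y. induction p as [| |i| |f gs IHf IHgs|f g IHf IHg|f IHf] using prog_nested_ind;
    intros l y; simpl.
  - intros [= <-]. constructor.
  - intros [= <-]. destruct l; constructor.
  - intros [= <-]. constructor.
  - intros [= <-]. apply (eOrac (fun _ => false)).
  - destruct forallb eqn:E; [|easy]. intros H. econstructor; [|apply IHf; exact H].
    clear H IHf. induction IHgs as [|g gs Hg _ IH]; simpl in *; constructor.
    + apply Hg. apply andb_prop, proj1, Nat.ltb_lt in E. lia.
    + apply IH. now apply andb_prop in E.
  - destruct l as [|n l]; [easy|]. revert y. induction n as [|n IH]; simpl; intros y H.
    + constructor. now apply IHf.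
    + destruct nat_rect as [|r] eqn:E; [easy|]. simpl in H. econstructor; [now apply IH|].
      now apply IHg.
  - set (step := fun i r => _). intros H.
    assert (forall n, match nat_rect (fun _ => nat) 0 step n with
      | 0 => forall z, z < n -> exists v, eval (fun _ => false) f (z :: l) (S v)
      | S 0 => True
      | S (S y) => eval (fun _ => false) (PMu f) l y
      end) as Hn.
    { intros n. induction n as [|n IH]; cbn [nat_rect]; [lia|].
      destruct (nat_rect _ 0 step n) as [|[|r]]; unfold step; simpl; [|exact I|exact IH].
      destruct bounded_eval as [|[|v]] eqn:Ev; simpl; [easy|constructor; auto|].
      intros z Hz. destruct (Nat.eq_dec z n) as [->|]; [eauto|]. apply IH. lia. }
    specialize (Hn t). destruct nat_rect as [|[|r]]; simpl in H; try easy. now injection H as <-.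
Qed.

(** A halting computation makes finitely many searches. Asking for all large [t] allows the
    thresholds of subcomputations to be combined by a maximum. *)
Lemma bounded_eval_complete p l y :
  eval (fun _ => false) p l y -> exists t0, forall t, t0 <= t -> bounded_eval t p l = S y.
Proof.
  revert l y. induction p as [| |i| |f gs IHf IHgs|f g IHf IHg|f IHf] using prog_nested_ind;
    intros l y H.
  - inversion H; subst. now exists 0.
  - inversion H; subst. exists 0. now destruct l.
  - inversion H; subst. now exists 0.
  - inversion H; subst. now exists 0.
  - inversion H as [| | | |? ? ? ys ? Hgs Hf| | |]; subst. clear H.
    apply IHf in Hf. destruct Hf as [t0 Ht0].
    assert (exists t1, forall t, t1 <= t -> map (fun g => bounded_eval t g l) gs = map S ys)
      as [t1 Ht1].
    { clear Ht0. revert ys Hgs.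
      induction IHgs as [|g gs Hg _ IH]; intros ys Hgs; inversion Hgs; subst; [now exists 0|].
      destruct (Hg l y0) as [t1 Ht1]; [assumption|].
      destruct (IH ys0) as [t2 Ht2]; [assumption|].
      exists (Nat.max t1 t2). intros t Ht. simpl. rewrite Ht1, Ht2; [easy|lia|lia]. }
    exists (Nat.max t0 t1). intros t Ht. simpl. rewrite Ht1 by lia.
    rewrite map_map. simpl. rewrite map_id.
    replace (forallb _ _) with true; [apply Ht0; lia|]. symmetry. apply forallb_forall.
    intros v Hv. apply in_map_iff in Hv. now destruct Hv as (? & <- & _).
  - destruct l as [|n l]; [inversion H|]. revert y H. induction n as [|n IH]; intros y H.
    + inversion H; subst. now apply IHf.
    + inversion H; subst.
      destruct (IH r) as [t1 Ht1]; [assumption|]. destruct (IHg _ _ H6) as [t2 Ht2].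
      exists (Nat.max t1 t2). intros t Ht. specialize (Ht1 t ltac:(lia)).
      simpl in *. rewrite Ht1. simpl. apply Ht2. lia.
  - inversion H as [| | | | | | |? ? ? H0 Hz]; subst. clear H.
    assert (exists t0, forall t, t0 <= t -> bounded_eval t f (y :: l) = 1 /\
       forall z, z < y -> exists v, bounded_eval t f (z :: l) = S (S v)) as [t0 Ht0].
    { apply IHf in H0. destruct H0 as [t1 Ht1].
      enough (forall n, n <= y -> exists t2, forall t, t2 <= t ->
        forall z, z < n -> exists v, bounded_eval t f (z :: l) = S (S v)) as Hn.
      { destruct (Hn y ltac:(lia)) as [t2 Ht2]. exists (Nat.max t1 t2). intros t Ht.
        split; [apply Ht1; lia|apply Ht2; lia]. }
      intros n. induction n as [|n IH]; intros Hn; [exists 0; lia|].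
      destruct (IH ltac:(lia)) as [t2 Ht2]. destruct (Hz n Hn) as [v Hv].
      apply IHf in Hv. destruct Hv as [t3 Ht3]. exists (Nat.max t2 t3). intros t Ht z Hzn.
      destruct (Nat.eq_dec z n) as [->|]; [exists v; apply Ht3; lia|]. apply Ht2; lia. }
    (* The search must still inspect the candidate [y], which takes [S y] rounds; afterwards its
       accumulator stays fixed. *)
    exists (Nat.max t0 (S y)). intros t Ht. destruct (Ht0 t ltac:(lia)) as [H1 H2]. simpl.
    set (step := fun i r => _).
    assert (forall n, n <= y -> nat_rect (fun _ => nat) 0 step n = 0) as Hn.
    { intros n. induction n as [|n IH]; intros Hn; [easy|]. simpl. rewrite IH by lia.
      unfold step. simpl. destruct (H2 n Hn) as [v ->]. easy. }
    assert (forall n, nat_rect (fun _ => nat) 0 step (S y + n) = S (S y)) as Hy.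
    { intros n. rewrite Nat.add_comm. induction n as [|n IH].
      - simpl. rewrite Hn by lia. unfold step. simpl. now rewrite H1.
      - simpl in *. rewrite IH. reflexivity. }
    replace t with (S y + (t - S y)) by lia. now rewrite Hy.
Qed.

(** * Bounded quantifiers, finite sets as binary numerals, course-of-values recursion *)

Lemma bmax_ext n f g : (forall i, i < n -> f i = g i) -> bmax n f = bmax n g.
Proof.
  induction n as [|n IH]; intros H; [easy|]. unfold bmax in *. simpl. rewrite IH, H; auto.
Qed.

Lemma bmax_ge n f i : i < n -> f i <= bmax n f.
Proof.
  induction n as [|n IH]; intros H; [easy|]. change (bmax (S n) f) with (Nat.max (bmax n f) (f n)).
  destruct (Nat.eq_dec i n) as [->|]; [lia|]. specialize (IH ltac:(lia)). lia.
Qed.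

Lemma bmax_attained n f : bmax n f = 0 \/ exists i, i < n /\ f i = bmax n f.
Proof.
  induction n as [|n IH]; [now left|]. change (bmax (S n) f) with (Nat.max (bmax n f) (f n)).
  destruct (Nat.max_spec (bmax n f) (f n)) as [[_ ->]|[_ ->]].
  - right. exists n. auto.
  - destruct IH as [IH|(i & Hi & IH)]; [now left|]. right. exists i. auto.
Qed.

Definition bex (n : nat) (f : nat -> bool) : bool := 0 <? bmax n (fun i => Nat.b2n (f i)).

Definition ball (n : nat) (f : nat -> bool) : bool := negb (bex n (fun i => negb (f i))).

Lemma bex_spec n f : bex n f = true <-> exists i, i < n /\ f i = true.
Proof.
  unfold bex. rewrite Nat.ltb_lt. split.
  - intros H. destruct (bmax_attained n (fun i => Nat.b2n (f i))) as [|(i & Hi & E)]; [lia|].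
    exists i. split; [easy|]. destruct (f i); [easy|]. simpl in E. lia.
  - intros (i & Hi & E). assert (H := bmax_ge n (fun i => Nat.b2n (f i)) i Hi). simpl in H.
    rewrite E in H. simpl in H. lia.
Qed.

Lemma ball_spec n f : ball n f = true <-> forall i, i < n -> f i = true.
Proof.
  unfold ball. rewrite negb_true_iff, <- not_true_iff_false, bex_spec. split.
  - intros H i Hi. destruct (f i) eqn:E; [easy|]. destruct H. exists i. now rewrite E.
  - intros H (i & Hi & E). now rewrite H in E.
Qed.

Lemma bex_ext n f g : (forall i, i < n -> f i = g i) -> bex n f = bex n g.
Proof. intros H. unfold bex. erewrite bmax_ext; [easy|]. intros i Hi. simpl. now rewrite H. Qed.

Lemma ball_ext n f g : (forall i, i < n -> f i = g i) -> ball n f = ball n g.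
Proof. intros H. unfold ball. erewrite bex_ext; [easy|]. intros i Hi. simpl. now rewrite H. Qed.

Lemma computable_bex k n f :
  computable k n -> computable (S k) (fun X l => Nat.b2n (f X (tl l) (nth 0 l 0))) ->
  computable k (fun X l => Nat.b2n (bex (n X l) (f X l))).
Proof. intros. unfold bex. comp. Qed.

Lemma computable_negb k a :
  computable k (fun X l => Nat.b2n (a X l)) -> computable k (fun X l => Nat.b2n (negb (a X l))).
Proof.
  intros H. apply computable_ext with (f := fun X l => 1 - Nat.b2n (a X l)); [|comp].
  intros X l _. now destruct (a X l).
Qed.

Lemma computable_ball k n f :
  computable k n -> computable (S k) (fun X l => Nat.b2n (f X (tl l) (nth 0 l 0))) ->
  computable k (fun X l => Nat.b2n (ball (n X l) (f X l))).
Proof.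
  intros. unfold ball. apply computable_negb, computable_bex; [assumption|].
  now apply computable_negb.
Qed.

Ltac comp_bool := repeat
  first [ progress comp
        | lazymatch goal with
          | |- computable _ (fun _ _ => Nat.b2n (negb _)) => apply computable_negb
          | |- computable _ (fun _ _ => Nat.b2n (bex _ _)) => apply computable_bex
          | |- computable _ (fun _ _ => Nat.b2n (ball _ _)) => apply computable_ball
          end ].

Definition agree (k : nat) (Y Z : nat -> bool) : Prop := forall i, i < k -> Y i = Z i.

Lemma bsum_ext n f g : (forall i, i < n -> f i = g i) -> bsum n f = bsum n g.
Proof.
  induction n as [|n IH]; intros H; [easy|]. unfold bsum in *. simpl. rewrite IH, H; auto.
Qed.

Definition mask (k : nat) (Y : nat -> bool) : nat := bsum k (fun i => Nat.b2n (Y i) * 2 ^ i).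

Lemma mask_ext k Y Z : agree k Y Z -> mask k Y = mask k Z.
Proof. intros H. apply bsum_ext. intros i Hi. now rewrite H. Qed.

Lemma mask_lt k Y : mask k Y < 2 ^ k.
Proof.
  induction k as [|k IH]; [simpl; unfold mask, bsum; simpl; lia|].
  change (mask (S k) Y) with (mask k Y + Nat.b2n (Y k) * 2 ^ k).
  rewrite Nat.pow_succ_r'. destruct (Y k); simpl; lia.
Qed.

Lemma testbit_mask k Y i : Nat.testbit (mask k Y) i = (i <? k) && Y i.
Proof.
  induction k as [|k IH].
  - simpl. apply Nat.bits_0.
  - change (mask (S k) Y) with (mask k Y + Nat.b2n (Y k) * 2 ^ k).
    assert (Hlt := mask_lt k Y). destruct (Nat.lt_trichotomy i k) as [Hi|[->|Hi]].
    + rewrite Nat.testbit_eqb. rewrite Nat.testbit_eqb in IH.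
      replace (i <? S k) with (i <? k) by (destruct (Nat.ltb_spec i k), (Nat.ltb_spec i (S k)); lia).
      rewrite <- IH. f_equal.
      (* As a multiple of [2 * 2 ^ i], the top summand does not affect bit [i]. *)
      replace (2 ^ k) with (2 ^ (k - S i) * 2 * 2 ^ i)
        by (rewrite <- Nat.mul_assoc, <- Nat.pow_succ_r', <- Nat.pow_add_r; f_equal; lia).
      rewrite !Nat.mul_assoc, Nat.div_add by (apply Nat.pow_nonzero; easy).
      apply Nat.Div0.mod_add.
    + rewrite (proj2 (Nat.ltb_lt k (S k))) by lia. simpl.
      rewrite Nat.testbit_eqb, Nat.div_add, Nat.div_small by (try apply Nat.pow_nonzero; easy).
      now destruct (Y k).
    + rewrite (proj2 (Nat.ltb_ge i (S k))) by lia. simpl.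
      apply Nat.testbit_false. assert (2 ^ S k <= 2 ^ i) by (apply Nat.pow_le_mono_r; lia).
      rewrite Nat.pow_succ_r' in *.
      rewrite Nat.div_small; [easy|]. destruct (Y k); simpl; lia.
Qed.

Lemma testbit_mask_agree k Y : agree k (Nat.testbit (mask k Y)) Y.
Proof. intros i Hi. rewrite testbit_mask. now rewrite (proj2 (Nat.ltb_lt i k) Hi). Qed.

(** A closed form of [code]: strings are bijective base-2 numerals with digits 1 and 2, least
    significant digit first. *)
Definition prefix_code (n : nat) (Y : nat -> bool) : nat :=
  bsum n (fun i => S (Nat.b2n (Y i)) * 2 ^ i).

Lemma bsum_S n f : bsum (S n) f = bsum n f + f n.
Proof. reflexivity. Qed.

Lemma prefix_code_spec n Y : prefix_code n Y = code (map Y (seq 0 n)).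
Proof.
  revert Y. induction n as [|n IH]; intros Y; [easy|]. cbn [seq map code].
  rewrite <- seq_shift, map_map, <- IH. clear IH. unfold prefix_code.
  induction n as [|n IH]; [unfold bsum; simpl; destruct (Y 0); simpl; lia|].
  rewrite bsum_S, IH, bsum_S, Nat.pow_succ_r'. nia.
Qed.

Lemma prefix_code_ext n Y Z : agree n Y Z -> prefix_code n Y = prefix_code n Z.
Proof. intros H. apply bsum_ext. intros i Hi. now rewrite H. Qed.

Definition digit (T i : nat) : nat := (T / 2 ^ (2 * i)) mod 2 ^ 2.

Definition table (g : nat -> nat -> nat -> nat) (k n : nat) : nat :=
  nat_rect (fun _ => nat) 0 (fun i T => T + g T i k * 2 ^ (2 * i)) n.

(** Course-of-values recursion: the values already computed are the base-4 digits of the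
    first argument of [g]. *)
Definition course (g : nat -> nat -> nat -> nat) (k i : nat) : nat := g (table g k i) i k.

(** Values below 4 produce no carry, so the entry at place [i] survives all later additions. *)
Lemma digit_table g k n i :
  (forall T i k, g T i k < 4) -> i < n -> digit (table g k n) i = course g k i.
Proof.
  intros Hg. unfold digit.
  assert (forall n, table g k n < 2 ^ (2 * n)) as Hlt.
  { clear n. intros n. induction n as [|n IH]; [simpl; lia|].
    change (table g k (S n)) with (table g k n + g (table g k n) n k * 2 ^ (2 * n)).
    specialize (Hg (table g k n) n k).
    replace (2 * S n) with (2 + 2 * n) by lia. rewrite Nat.pow_add_r.
    change (2 ^ 2) with 4. nia. }
  induction n as [|n IH]; [lia|]. intros Hi.
  change (table g k (S n)) with (table g k n + course g k n * 2 ^ (2 * n)).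
  destruct (Nat.eq_dec i n) as [->|Hin].
  - rewrite Nat.div_add, Nat.div_small by (try apply Nat.pow_nonzero; easy).
    apply Nat.mod_small, Hg.
  - rewrite <- IH by lia.
    replace (2 ^ (2 * n)) with (2 ^ (2 * (n - S i)) * 2 ^ 2 * 2 ^ (2 * i))
      by (rewrite <- !Nat.pow_add_r; f_equal; lia).
    rewrite !Nat.mul_assoc, Nat.div_add by (apply Nat.pow_nonzero; easy).
    apply Nat.Div0.mod_add.
Qed.

Lemma computable_course g :
  computable 3 (fun X l => g (nth 0 l 0) (nth 1 l 0) (nth 2 l 0)) ->
  computable 2 (fun X l => course g (nth 0 l 0) (nth 1 l 0)).
Proof.
  intros Hg. apply computable_comp3; try comp. unfold table.
  apply (computable_rec 2 _ (fun i T X l => T + g T i (nth 0 l 0) * 2 ^ (2 * i))); comp.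
  apply computable_comp3; comp.
Qed.

#[local] Arguments bmax : simpl never.

(** * The selection process and its finite approximations *)

Definition above (s : nat) (Y : nat -> bool) : nat -> bool := fun i => (s <? i) && Y i.

Definition union (G Y : nat -> bool) : nat -> bool := fun i => G i || Y i.

Definition insert (e : nat) (Y : nat -> bool) : nat -> bool := fun i => (i =? e) || Y i.

Definition least (Y : nat -> bool) (s : nat) : Prop := Y s = true /\ forall i, i < s -> Y i = false.

Definition leastb (Y : nat -> bool) (s : nat) : bool := Y s && negb (bex s Y).

Lemma leastb_spec Y s : leastb Y s = true <-> least Y s.
Proof.
  unfold leastb, least. rewrite andb_true_iff, negb_true_iff, <- not_true_iff_false, bex_spec.
  split; intros [H1 H2]; (split; [easy|]).
  - intros i Hi. apply not_true_iff_false. eauto.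
  - intros (i & Hi & H). rewrite H2 in H; easy.
Qed.

Lemma least_unique Y s s' : least Y s -> least Y s' -> s = s'.
Proof.
  intros [H1 H2] [H1' H2']. destruct (Nat.lt_trichotomy s s') as [H|[H|H]]; [|easy|].
  - now rewrite H2' in H1.
  - now rewrite H2 in H1'.
Qed.

Lemma least_exists Y s : Y s = true -> exists s', least Y s'.
Proof.
  induction s as [s IH] using lt_wf_ind. intros Hs.
  destruct (bex s Y) eqn:E.
  - apply bex_spec in E. destruct E as (i & Hi & E). eauto.
  - exists s. apply leastb_spec. unfold leastb. now rewrite Hs, E.
Qed.

Lemma agree_above k s Y Z : agree k Y Z -> agree k (above s Y) (above s Z).
Proof. intros H i Hi. unfold above. now rewrite H. Qed.

Lemma agree_union k G Y Z : agree k Y Z -> agree k (union G Y) (union G Z).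
Proof. intros H i Hi. unfold union. now rewrite H. Qed.

Lemma agree_insert k e Y Z : agree k Y Z -> agree k (insert e Y) (insert e Z).
Proof. intros H i Hi. unfold insert. now rewrite H. Qed.

Lemma agree_le k k' Y Z : k <= k' -> agree k' Y Z -> agree k Y Z.
Proof. intros H1 H2 i Hi. apply H2. lia. Qed.

Lemma infinite_superset Y Z : infinite Y -> subset Y Z -> infinite Z.
Proof. intros H1 H2 n. destruct (H1 n) as (m & Hm & H). eauto. Qed.

Lemma infinite_above s Y : infinite Y -> infinite (above s Y).
Proof.
  intros H n. destruct (H (n + S s)) as (m & Hm & Hy). exists m. split; [lia|].
  unfold above. rewrite Hy, (proj2 (Nat.ltb_lt s m)); [easy|lia].
Qed.

Lemma subset_above s Y : subset (above s Y) Y.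
Proof. intros i Hi. unfold above in Hi. now apply andb_prop in Hi. Qed.

Section Approximation.

Variable en : nat -> (nat -> bool) -> nat -> bool.
Variable piv : nat -> nat.

Definition accepted (c : nat) (Y : nat -> bool) : Prop :=
  exists s, least Y s /\
    forall j, en j (above s Y) (piv s) = true -> en j (above s Y) c = true.

(** Both approximations below take the values [0] (undecided), [1] (no) and [2] (yes). *)
Definition accepted_at (k c : nat) (Y : nat -> bool) : nat :=
  bmax k (fun s =>
    if leastb Y s && en k (above s Y) (piv s) then
      if ball (S k) (fun j => negb (en j (above s Y) (piv s)) || en j (above s Y) c)
      then 2 else 1
    else 0).

(** Recursion on the bound [n], with [Y] left free, lets the clause for [e] run the process below
    [e] on sets other than [Y]. *)
Fixpoint selected (n : nat) (Y : nat -> bool) (i : nat) : Prop :=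
  match n with
  | 0 => False
  | S e =>
      selected e Y i \/
      (i = e /\ accepted e Y /\
       forall b, selected e Y b ->
       forall G : nat -> bool, (forall g, G g = true -> b < g /\ selected e Y g) ->
       forall a, a <= b -> (selected e (union G (insert e Y)) a <-> selected e Y a))
  end.

(** One round of the process, with the earlier verdicts supplied by [look]. The outer [bmax]
    collects objections to [e]: 2 for a missing verdict, 1 for a violated consistency clause, 0 for
    none. Hence [2 - bmax] reads as undecided, no or yes, and a missing verdict outweighs a
    violation. *)
Definition rule (k e : nat) (Y : nat -> bool) (look : nat -> (nat -> bool) -> nat) : nat :=
  if accepted_at k e Y =? 2 then
    2 - bmax e (fun b =>
      if look b Y =? 2 then
        bmax (2 ^ e) (fun G =>
          if ball e (fun g => negb (Nat.testbit G g) || ((b <? g) && (look g Y =? 2))) then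
            bmax (S b) (fun a =>
              if look a (union (Nat.testbit G) (insert e Y)) =? 0 then 2
              else if look a (union (Nat.testbit G) (insert e Y)) =? look a Y then 0 else 1)
          else 0)
      else if look b Y =? 0 then 2 else 0)
  else accepted_at k e Y.

(** Since other sets are consulted, the table has an entry for every pair of an element and a subset
    of the numbers below [k]; [mask] cuts unions off at [k]. *)
Definition rule_course (T i k : nat) : nat :=
  rule k (i / 2 ^ k) (Nat.testbit (i mod 2 ^ k)) (fun a Z => digit T (a * 2 ^ k + mask k Z)).

(** The pair of [e] and a set below [k] is the index [e * 2 ^ k + mask k Y] of the recursion. *)
Definition selected_at (k e : nat) (Y : nat -> bool) : nat :=
  course rule_course k (e * 2 ^ k + mask k Y).

Lemma accepted_at_le k c Y : accepted_at k c Y <= 2.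
Proof.
  unfold accepted_at.
  match goal with |- bmax _ ?f <= _ => destruct (bmax_attained k f) as [->|(s & _ & <-)] end; [lia|].
  destruct andb; [destruct ball|]; lia.
Qed.

Lemma rule_le k e Y look : rule k e Y look <= 2.
Proof. unfold rule. destruct Nat.eqb; [lia|apply accepted_at_le]. Qed.

Hypothesis en_mono : forall j j' Y x, j <= j' -> en j Y x = true -> en j' Y x = true.
Hypothesis en_ext : forall j Y Z x, agree j Y Z -> en j Y x = en j Z x.

Lemma accepted_at_ext k c Y Z : agree k Y Z -> accepted_at k c Y = accepted_at k c Z.
Proof.
  intros H. apply bmax_ext. intros s Hs.
  replace (leastb Z s) with (leastb Y s).
  2: { unfold leastb. rewrite (H s Hs). f_equal. f_equal. apply bex_ext. intros i Hi. apply H. lia. }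
  assert (forall j x, j <= k -> en j (above s Y) x = en j (above s Z) x) as E.
  { intros j x Hj. apply en_ext, agree_above. now apply agree_le with k. }
  rewrite (E k) by easy. destruct andb; [|easy].
  erewrite ball_ext; [easy|]. intros j Hj. simpl. now rewrite !E by lia.
Qed.

Lemma rule_ext k e Y Z look look' :
  agree k Y Z ->
  (forall a Y' Z', a < e -> agree k Y' Z' -> look a Y' = look' a Z') ->
  rule k e Y look = rule k e Z look'.
Proof.
  intros H Hl. unfold rule. rewrite (accepted_at_ext k e Y Z H).
  destruct Nat.eqb; [|easy]. f_equal. apply bmax_ext. intros b Hb. simpl.
  rewrite (Hl b Y Z) by easy. destruct (look' b Z =? 2); [|easy].
  apply bmax_ext. intros G HG. simpl.
  rewrite (ball_ext e _ (fun g => negb (Nat.testbit G g) || (b <? g) && (look' g Z =? 2)))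
    by (intros g Hg; simpl; now rewrite (Hl g Y Z)).
  destruct ball; [|easy]. apply bmax_ext. intros a Ha. simpl.
  rewrite (Hl a Y Z), (Hl a _ (union (Nat.testbit G) (insert e Z))); try easy; try lia.
  now apply agree_union, agree_insert.
Qed.

Lemma selected_at_eq k e Y : selected_at k e Y = rule k e Y (selected_at k).
Proof.
  assert (Hlt := mask_lt k Y).
  change (rule_course (table rule_course k (e * 2 ^ k + mask k Y)) (e * 2 ^ k + mask k Y) k =
    rule k e Y (selected_at k)).
  set (T := table _ _ _). unfold rule_course.
  rewrite Nat.div_add_l, (Nat.div_small (mask k Y)), Nat.add_0_r by (try apply Nat.pow_nonzero; easy).
  rewrite Nat.add_comm, Nat.Div0.mod_add, Nat.mod_small by easy.
  apply rule_ext; [apply testbit_mask_agree|].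
  intros a Y' Z' Ha HYZ. unfold T. rewrite digit_table.
  - now rewrite (mask_ext k Y' Z').
  - intros T0 i k'. apply Nat.lt_succ_r, Nat.le_trans with 2; [apply rule_le|lia].
  (* A smaller element has a smaller index, whatever the set, because masks stay below [2 ^ k]. *)
  - assert (Hlt' := mask_lt k Y'). nia.
Qed.

Lemma selected_at_le k e Y : selected_at k e Y <= 2.
Proof. rewrite selected_at_eq. apply rule_le. Qed.

Lemma selected_at_ext k e Y Z : agree k Y Z -> selected_at k e Y = selected_at k e Z.
Proof. intros H. unfold selected_at. now rewrite (mask_ext k Y Z). Qed.

Lemma selected_lt n Y i : selected n Y i -> i < n.
Proof. induction n as [|n IH]; simpl; [easy|]. intros [H|[-> _]]; [apply IH in H|]; lia. Qed.

Lemma selected_stable n m Y i : i < n -> n <= m -> (selected m Y i <-> selected n Y i).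
Proof.
  intros Hi Hnm. induction Hnm as [|m Hnm IH]; [easy|]. rewrite <- IH. simpl.
  split; [intros [H|[-> _]]; [easy|lia]|now left].
Qed.

Lemma accepted_at_sound k c Y :
  (accepted_at k c Y = 2 -> accepted c Y) /\ (accepted_at k c Y = 1 -> ~ accepted c Y).
Proof.
  unfold accepted_at.
  match goal with |- context [bmax _ ?f] => destruct (bmax_attained k f) as [->|(s & _ & <-)] end; [easy|].
  destruct (leastb Y s) eqn:El; simpl; [|easy]. apply leastb_spec in El.
  destruct en eqn:Ep; [|easy]. destruct ball eqn:Eb; (split; [try easy|try easy]); intros _.
  - exists s. split; [easy|]. intros j Hj. rewrite ball_spec in Eb.
    (* Stages past [k] follow from stage [k], where [c] is already enumerated, by monotonicity. *)
    destruct (Nat.le_gt_cases j k) as [Hjk|Hjk].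
    + specialize (Eb j ltac:(lia)). now rewrite Hj in Eb.
    + specialize (Eb k ltac:(lia)). rewrite Ep in Eb. apply en_mono with k; [lia|easy].
  - intros (s' & Hs' & H). rewrite (least_unique Y s' s) in H by easy. clear Hs' s'.
    apply not_true_iff_false in Eb. apply Eb, ball_spec. intros j _.
    destruct (en j (above s Y) (piv s)) eqn:E; [|easy]. now rewrite H.
Qed.

Lemma testbit_lt G e g : G < 2 ^ e -> Nat.testbit G g = true -> g < e.
Proof.
  intros HG Hg. destruct (Nat.lt_ge_cases g e) as [|Hge]; [easy|].
  rewrite <- (Nat.mod_small G (2 ^ e)) in Hg by easy. now rewrite Nat.mod_pow2_bits_high in Hg.
Qed.

Lemma testbit_mask_below e G :
  (forall g, G g = true -> g < e) -> Nat.testbit (mask e G) = G.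
Proof.
  intros H. apply functional_extensionality. intros g. rewrite testbit_mask.
  destruct (G g) eqn:E; [|apply andb_false_r].
  now rewrite (proj2 (Nat.ltb_lt g e)) by auto.
Qed.

(** Strong induction on [e] for all sets at once, since the consistency clause compares [Y] with
    [union G (insert e Y)]. Nonzero verdicts below [e] can then be exchanged for the process
    itself. *)
Lemma selected_at_sound k e Y :
  (selected_at k e Y = 2 -> selected (S e) Y e) /\
  (selected_at k e Y = 1 -> ~ selected (S e) Y e).
Proof.
  revert Y. induction e as [e IH] using lt_wf_ind. intros Y.
  assert (forall a Z, a < e -> selected_at k a Z <> 0 ->
    (selected e Z a <-> selected_at k a Z = 2)) as Hs.
  { intros a Z Ha Hn. rewrite (selected_stable (S a)) by lia. destruct (IH a Ha Z) as [H2 H1].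
    assert (Hle := selected_at_le k a Z).
    destruct (selected_at k a Z) as [|[|[|]]]; [easy| |easy|lia]. split; [|easy]. intros H. now destruct H1. }
  rewrite selected_at_eq. unfold rule.
  assert (~ selected e Y e) as Hne by (intros H; apply selected_lt in H; lia).
  destruct (Nat.eqb_spec (accepted_at k e Y) 2) as [Ea|Ea].
  2: { split; [easy|]. intros H1 [H|(_ & H & _)]; [easy|].
       now apply (accepted_at_sound k e Y) in H1. }
  match goal with |- context [bmax e ?f] => set (F := f) end.
  split; intros HM.
  - right. split; [easy|]. split; [now apply (accepted_at_sound k e Y)|].
    assert (forall b, b < e -> F b = 0) as HF by (intros b Hb; assert (H := bmax_ge e F b Hb); lia).
    clear HM.
    assert (forall b, b < e -> selected_at k b Y <> 0) as Hn.
    { intros b Hb E. specialize (HF b Hb). unfold F in HF. rewrite E in HF. discriminate. }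
    intros b Hb G HG a Hab. assert (b < e) as Hbe by now apply selected_lt in Hb.
    assert (HFb := HF b Hbe). unfold F in HFb. apply Hs in Hb; [|easy|auto]. rewrite Hb in HFb. simpl in HFb.
    assert (forall g, G g = true -> g < e) as HGe by (intros g Hg; now apply HG, proj2, selected_lt in Hg).
    (* Members of [G] are selected and hence below [e], so [mask e G] is among the codes that were
       searched. *)
    match type of HFb with bmax _ ?f = 0 => assert (H := bmax_ge _ f (mask e G) (mask_lt e G)) end.
    rewrite HFb in H. simpl in H. rewrite testbit_mask_below in H by easy.
    replace (ball e _) with true in H.
    2: { symmetry. apply ball_spec. intros g Hg. destruct (G g) eqn:E; [|easy].
         destruct (HG g E) as [H1 H2]. apply Hs in H2; [|easy|auto]. simpl.
         rewrite H2, (proj2 (Nat.ltb_lt b g)); easy. }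
    match type of H with bmax _ ?f <= _ => assert (H1 := bmax_ge (S b) f a ltac:(lia)) end.
    simpl in H1. assert (a < e) as Hae by lia.
    destruct (Nat.eqb_spec (selected_at k a (union G (insert e Y))) 0) as [|E0]; [lia|].
    destruct (Nat.eqb_spec (selected_at k a (union G (insert e Y))) (selected_at k a Y)) as [E|]; [|lia].
    rewrite !Hs by auto. now rewrite E.
  - intros [H|(_ & _ & H)]; [easy|].
    (* The largest objection is exactly 1: nothing consulted is undecided, and some [b], [G] and [a]
       witness a violation. *)
    assert (bmax e F = 1) as HM' by lia.
    destruct (bmax_attained e F) as [|(b & Hb & E)]; [lia|].
    assert (forall b, b < e -> selected_at k b Y <> 0) as Hn.
    { intros b' Hb' E'. assert (H1 := bmax_ge e F b' Hb'). unfold F at 1 in H1. rewrite E' in H1.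
      simpl in H1. lia. }
    rewrite HM' in E. unfold F in E. specialize (H b). rewrite Hs in H by auto.
    destruct (Nat.eqb_spec (selected_at k b Y) 2) as [Eb|]; [|destruct Nat.eqb; discriminate].
    match type of E with bmax ?n ?f = _ => destruct (bmax_attained n f) as [|(G & HG & E')] end; [lia|].
    rewrite E in E'. destruct ball eqn:EG; [|discriminate].
    match type of E' with bmax ?n ?f = _ => destruct (bmax_attained n f) as [|(a & Ha & E'')] end; [lia|].
    rewrite E' in E''.
    destruct (Nat.eqb_spec (selected_at k a (union (Nat.testbit G) (insert e Y))) 0) as [|E0]; [discriminate|].
    destruct (Nat.eqb_spec (selected_at k a (union (Nat.testbit G) (insert e Y))) (selected_at k a Y)) as [|E1]; [discriminate|].
    specialize (H Eb (Nat.testbit G)).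
    assert (selected e (union (Nat.testbit G) (insert e Y)) a <-> selected e Y a) as H'.
    { apply H; [|lia]. intros g Hg. rewrite ball_spec in EG.
      assert (g < e) as Hge by now apply (testbit_lt G).
      specialize (EG g Hge). rewrite Hg in EG. simpl in EG. apply andb_prop in EG.
      destruct EG as [H1 H2]. apply Nat.ltb_lt in H1. apply Nat.eqb_eq in H2.
      split; [easy|]. apply Hs; auto. }
    (* The two verdicts on [a] are 1 or 2 and differ, while [H'] makes one of them 2 exactly when
       the other is. *)
    rewrite (Hs a Y), Hs in H' by (easy || (try apply Hn; lia)). clear - H' E0 E1 Hn Ha Hb en_ext.
    assert (H1 := selected_at_le k a Y). specialize (Hn a ltac:(lia)).
    assert (H2 := selected_at_le k a (union (Nat.testbit G) (insert e Y))). lia.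
Qed.

Lemma selected_at_decides k e Y :
  selected_at k e Y <> 0 -> (selected (S e) Y e <-> selected_at k e Y = 2).
Proof.
  intros Hn. destruct (selected_at_sound k e Y) as [H2 H1]. assert (Hle := selected_at_le k e Y).
  destruct (selected_at k e Y) as [|[|[|]]]; [easy| |easy|lia]. split; [|easy].
  intros H. now destruct H1.
Qed.

(** * Termination of the approximations on infinite subsets of [A] *)

Variable A : nat -> bool.
Hypothesis en_total : forall Y x, infinite Y -> subset Y A ->
  ((exists j, en j Y x = true) <-> A x = true).
Hypothesis piv_in : forall s, A s = true -> A (piv s) = true.

(** The pivot of the least element lies in [A], so [above s Y] enumerates it at some stage.
    Acceptance puts [c] in that same stage, and only members of [A] are enumerated. *)
Lemma accepted_in c Y : infinite Y -> subset Y A -> accepted c Y -> A c = true.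
Proof.
  intros HY HA (s & Hs & H).
  assert (infinite (above s Y)) as HY' by now apply infinite_above.
  assert (subset (above s Y) A) as HA' by (intros i Hi; now apply subset_above, HA in Hi).
  apply (en_total (above s Y) c HY' HA').
  destruct (proj2 (en_total (above s Y) (piv s) HY' HA')) as [j Hj].
  - apply piv_in, HA, Hs.
  - eauto.
Qed.

Lemma selected_in n Y i : infinite Y -> subset Y A -> selected n Y i -> A i = true.
Proof.
  intros HY HA. induction n as [|n IH]; simpl; [easy|]. intros [H|(-> & H & _)]; [auto|].
  now apply (accepted_in n Y).
Qed.

Definition eventually (P : nat -> Prop) : Prop := exists k0, forall k, k0 <= k -> P k.

Lemma eventually_and (P Q : nat -> Prop) :
  eventually P -> eventually Q -> eventually (fun k => P k /\ Q k).
Proof.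
  intros [k1 H1] [k2 H2]. exists (Nat.max k1 k2). intros k Hk. split; [apply H1|apply H2]; lia.
Qed.

Lemma eventually_imp (P Q : nat -> Prop) :
  (forall k, P k -> Q k) -> eventually P -> eventually Q.
Proof. intros H [k0 H0]. exists k0. auto. Qed.

Lemma eventually_forall n (P : nat -> nat -> Prop) :
  (forall i, i < n -> eventually (P i)) -> eventually (fun k => forall i, i < n -> P i k).
Proof.
  induction n as [|n IH]; intros H; [exists 0; intros; lia|].
  eapply eventually_imp; [|exact (eventually_and _ _ (IH (fun i Hi => H i ltac:(lia))) (H n ltac:(lia)))].
  simpl. intros k [H1 H2] i Hi. destruct (Nat.eq_dec i n) as [->|]; [easy|apply H1; lia].
Qed.

Lemma accepted_at_complete c Y :
  infinite Y -> subset Y A -> eventually (fun k => accepted_at k c Y <> 0).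
Proof.
  intros HY HA. destruct (HY 0) as (m & _ & Hm). destruct (least_exists Y m Hm) as [s Hs].
  destruct (proj2 (en_total (above s Y) (piv s) (infinite_above s Y HY)
    (fun i Hi => HA i (subset_above s Y i Hi)))) as [j Hj].
  { apply piv_in, HA, Hs. }
  exists (S (Nat.max s j)). intros k Hk E.
  assert (H := bmax_ge k _ s ltac:(lia) : _ <= accepted_at k c Y). rewrite E in H. simpl in H.
  rewrite (proj2 (leastb_spec Y s) Hs), (en_mono j k) in H by (easy || lia). simpl in H.
  destruct ball; lia.
Qed.

(** Strong induction on [e]. If [e] is not accepted, deciding acceptance suffices. If it is, then
    [e] lies in [A], so the finitely many sets [union G (insert e Y)] to be consulted are infinite
    subsets of [A], to which the induction hypothesis applies. *)
Lemma selected_at_complete e Y :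
  infinite Y -> subset Y A -> eventually (fun k => selected_at k e Y <> 0).
Proof.
  revert Y. induction e as [e IH] using lt_wf_ind. intros Y HY HA.
  destruct (classic (accepted e Y)) as [Hacc|Hacc].
  2: { eapply eventually_imp; [|apply (accepted_at_complete e Y HY HA)]. intros k Hk.
       rewrite selected_at_eq. unfold rule. destruct (Nat.eqb_spec (accepted_at k e Y) 2) as [E|]; [|easy].
       now apply accepted_at_sound in E. }
  assert (A e = true) as Ae by now apply (accepted_in e Y).
  assert (eventually (fun k => forall b, b < e -> selected_at k b Y <> 0)) as H1.
  { apply eventually_forall. auto. }
  assert (eventually (fun k => forall G, G < 2 ^ e ->
    (forall g, g < e -> Nat.testbit G g = true -> selected (S g) Y g) ->
    forall a, a < e -> selected_at k a (union (Nat.testbit G) (insert e Y)) <> 0)) as H2.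
  { apply eventually_forall. intros G HG.
    (* Only sets [G] of selected elements are known to lie in [A]; for the others the claim is
       vacuous. *)
    destruct (classic (forall g, g < e -> Nat.testbit G g = true -> selected (S g) Y g)) as [H|H];
      [|now exists 0].
    eapply eventually_imp; [intros k Hk _; exact Hk|].
    apply eventually_forall. intros a Ha. apply IH; [easy| |].
    - apply (infinite_superset Y); [easy|]. intros i Hi. unfold union, insert.
      now rewrite Hi, !orb_true_r.
    - intros i Hi. unfold union, insert in Hi. apply orb_prop in Hi as [Hi|Hi].
      + assert (i < e) as Hie by now apply (testbit_lt G).
        now apply (selected_in (S i) Y); auto.
      + apply orb_prop in Hi as [Hi|Hi]; [apply Nat.eqb_eq in Hi; now subst|auto]. }
  eapply eventually_imp;
    [|exact (eventually_and _ _ (accepted_at_complete e Y HY HA) (eventually_and _ _ H1 H2))].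
  clear H1 H2. intros k (Hk & H1 & H2). rewrite selected_at_eq. unfold rule.
  destruct (Nat.eqb_spec (accepted_at k e Y) 2) as [E|]; [|easy].
  match goal with |- 2 - bmax _ ?f <> 0 => destruct (bmax_attained e f) as [->|(b & Hb & <-)] end; [lia|].
  destruct (Nat.eqb_spec (selected_at k b Y) 2) as [Eb|].
  2: { specialize (H1 b Hb). now destruct (Nat.eqb_spec (selected_at k b Y) 0). }
  match goal with |- 2 - bmax _ ?f <> 0 => destruct (bmax_attained (2 ^ e) f) as [->|(G & HG & <-)] end; [lia|].
  destruct ball eqn:EG; [|lia].
  match goal with |- 2 - bmax _ ?f <> 0 => destruct (bmax_attained (S b) f) as [->|(a & Ha & <-)] end; [lia|].
  destruct (Nat.eqb_spec (selected_at k a (union (Nat.testbit G) (insert e Y))) 0) as [E0|].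
  - exfalso. revert E0. apply H2; [easy| |lia]. intros g Hg Hb'. rewrite ball_spec in EG.
    specialize (EG g Hg). rewrite Hb' in EG. simpl in EG. apply andb_prop in EG.
    destruct EG as [_ EG]. apply Nat.eqb_eq in EG. now apply (selected_at_sound k).
  - destruct Nat.eqb; lia.
Qed.

End Approximation.

(** * Ramsey's theorem for clopen colourings *)

Lemma dependent_choice {T : Type} (P : nat -> T -> Prop) (R : nat -> T -> T -> Prop) (x0 : T) :
  P 0 x0 -> (forall n x, P n x -> exists y, P (S n) y /\ R n x y) ->
  exists f : nat -> T, f 0 = x0 /\ forall n, P n (f n) /\ R n (f n) (f (S n)).
Proof.
  intros H0 Hstep.
  (* Outside the invariant the default [x0] is taken, so that a successor function exists on all of
     [T]. *)
  assert (forall n x, {y | P n x -> P (S n) y /\ R n x y}) as next.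
  { intros n x. apply constructive_indefinite_description.
    destruct (classic (P n x)) as [H|H]; [destruct (Hstep n x H); eauto|now exists x0]. }
  set (f := nat_rect (fun _ => T) x0 (fun n x => proj1_sig (next n x))).
  assert (forall n, P n (f n)) as HP.
  { intros n. induction n as [|n IH]; [easy|]. simpl. now apply (proj2_sig (next n (f n))). }
  exists f. split; [easy|]. intros n. split; [apply HP|].
  simpl. now apply (proj2_sig (next n (f n))).
Qed.

Definition homogeneous (chi : (nat -> bool) -> Prop) (X : nat -> bool) : Prop :=
  (forall S, infinite S -> subset S X -> chi S) \/
  (forall S, infinite S -> subset S X -> ~ chi S).

Lemma subset_trans X Y Z : subset X Y -> subset Y Z -> subset X Z.
Proof. intros H1 H2 i Hi. auto. Qed.

(** Used to pass from the stem [F] to a longer one: the least element of [Y] joins the stem and the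
    rest lies above it. *)
Lemma insert_above s Y F :
  least Y s -> union (insert s F) (above s Y) = union F Y.
Proof.
  intros [Hs Hl]. apply functional_extensionality. intros i. unfold union, insert, above.
  destruct (Nat.eqb_spec i s) as [->|Hi]; simpl.
  - now rewrite Hs, orb_true_r.
  - destruct (Nat.ltb_spec s i); simpl; [easy|]. rewrite (Hl i) by lia. easy.
Qed.

(** [Y] collects the [x i] for which [Q] holds throughout [Z (S i)] with stem [insert (x i) F]. An
    infinite subset has such an [x i] as its least element, and its other members are later points,
    which lie in [Z (S i)] because the sets decrease. *)
Lemma diagonal_set (Q : (nat -> bool) -> Prop) F X (x : nat -> nat) (Z : nat -> nat -> bool) :
  subset (Z 0) X ->
  (forall i, Z i (x i) = true /\ subset (Z (S i)) (Z i) /\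
     forall j, Z (S i) j = true -> x i < j) ->
  (forall n, exists i, n <= i /\
     forall S', infinite S' -> subset S' (Z (S i)) -> Q (union (insert (x i) F) S')) ->
  exists Y, infinite Y /\ subset Y X /\
    forall S', infinite S' -> subset S' Y -> Q (union F S').
Proof.
  intros H0 HZ Hinf.
  assert (forall i j, i <= j -> subset (Z j) (Z i)) as Hmono.
  { intros i j Hij. induction Hij as [|j Hij IH]; [easy|].
    apply subset_trans with (Z j); [apply HZ|easy]. }
  assert (forall i j, i < j -> x i < x j) as Hx.
  { intros i j Hij. apply (HZ i). apply (Hmono (S i) j Hij), (proj1 (HZ j)). }
  assert (forall i, i <= x i) as Hid.
  { intros i. induction i as [|i IH]; [lia|]. specialize (Hx i (S i) ltac:(lia)). lia. }
  set (I := fun i => forall S', infinite S' -> subset S' (Z (S i)) -> Q (union (insert (x i) F) S')).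
  set (Y := fun j => if excluded_middle_informative (exists i, I i /\ j = x i) then true else false).
  assert (forall j, Y j = true <-> exists i, I i /\ j = x i) as HY.
  { intros j. unfold Y. now destruct excluded_middle_informative. }
  exists Y. split; [|split].
  - intros n. destruct (Hinf n) as (i & Hi & HI). exists (x i).
    split; [specialize (Hid i); lia|]. apply HY. now exists i.
  - intros j Hj. apply HY in Hj. destruct Hj as (i & _ & ->). apply H0, (Hmono 0 i); [lia|exact (proj1 (HZ i))].
  - intros S' HS' HSY. destruct (HS' 0) as (j & _ & Hj).
    destruct (least_exists S' j Hj) as [s Hs]. assert (Hs' := proj1 Hs).
    apply HSY, HY in Hs'. destruct Hs' as (i & HI & ->).
    rewrite <- (insert_above (x i)) by easy. apply HI; [now apply infinite_above|].
    intros l Hl. unfold above in Hl. apply andb_prop in Hl. destruct Hl as [Hl1 Hl2].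
    apply HSY, HY in Hl2. destruct Hl2 as (i' & _ & ->). apply Nat.ltb_lt in Hl1.
    apply (Hmono (S i) i'); [|exact (proj1 (HZ i'))].
    destruct (Nat.lt_trichotomy i' i) as [H|[->|H]]; [|lia|easy]. specialize (Hx i' i H). lia.
Qed.

(** Bar induction on the finite stems [F] below [m]: continuity provides the bar, where the colour
    is already constant, and [diagonal_set] the inductive step. *)
Theorem clopen_ramsey (A : nat -> bool) (chi : (nat -> bool) -> Prop) :
  infinite A ->
  (forall Y, infinite Y -> subset Y A ->
    exists k, forall Z, infinite Z -> subset Z A -> agree k Y Z -> (chi Y <-> chi Z)) ->
  exists X, infinite X /\ subset X A /\ homogeneous chi X.
Proof.
  intros HA Hcont.
  set (good := fun (F : nat -> bool) (m : nat) =>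
    forall X, infinite X -> subset X A -> (forall i, X i = true -> m <= i) ->
    exists Y, infinite Y /\ subset Y X /\ homogeneous (fun S' => chi (union F S')) Y).
  assert (forall F m,
    (forall n, m <= n -> A n = true -> good (insert n F) (S n)) -> good F m) as Hbar.
  { intros F m Hn X HX HXA HXm.
    (* Each step takes an element [x] of the reservoir and a part of the reservoir above [x] that is
       homogeneous for the stem extended by [x]. The [0] in the initial pair is a dummy. *)
    destruct (dependent_choice
      (fun _ (u : nat * (nat -> bool)) => infinite (snd u) /\ subset (snd u) X)
      (fun _ u v => snd u (fst v) = true /\ subset (snd v) (snd u) /\
         (forall j, snd v j = true -> fst v < j) /\
         homogeneous (fun S' => chi (union (insert (fst v) F) S')) (snd v))
      (0, X)) as (f & Hf0 & Hf).
    { split; [exact HX|now intros i]. }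
    { intros _ [y Z] [HZ HZX]. simpl in *. destruct (HZ 0) as (x & _ & Hx).
      destruct (Hn x (HXm x (HZX x Hx)) (HXA x (HZX x Hx)) (above x Z)) as (Y & HY & HYZ & Hhom).
      - now apply infinite_above.
      - intros i Hi. now apply subset_above, HZX, HXA in Hi.
      - intros i Hi. unfold above in Hi. apply andb_prop in Hi. now apply Nat.ltb_lt.
      - exists (x, Y). simpl.
        assert (subset Y Z) as HYZ' by (intros i Hi; now apply HYZ, subset_above in Hi).
        repeat split; try easy.
        + now apply subset_trans with Z.
        + intros j Hj. apply HYZ in Hj. unfold above in Hj. apply andb_prop in Hj.
          now apply Nat.ltb_lt. }
    set (x := fun i => fst (f (S i))). set (Z := fun i => snd (f i)).
    assert (forall i, Z i (x i) = true /\ subset (Z (S i)) (Z i) /\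
      forall j, Z (S i) j = true -> x i < j) as HZ.
    { intros i. destruct (Hf i) as [_ (H1 & H2 & H3 & _)]. auto. }
    assert (subset (Z 0) X) as H0 by (unfold Z; rewrite Hf0; now intros i).
    (* One of the two colours recurs for arbitrarily large [i], and [diagonal_set] is applied to
       that colour. *)
    destruct (classic (forall n, exists i, n <= i /\ forall S', infinite S' ->
      subset S' (Z (S i)) -> chi (union (insert (x i) F) S'))) as [H|H].
    - destruct (diagonal_set chi F X x Z H0 HZ H) as (Y & H1 & H2 & H3).
      exists Y. split; [easy|]. split; [easy|]. now left.
    - destruct (diagonal_set (fun S' => ~ chi S') F X x Z H0 HZ) as (Y & H1 & H2 & H3).
      + apply not_all_ex_not in H. destruct H as [n H]. intros n'. exists (Nat.max n n').
        split; [lia|]. destruct (Hf (Nat.max n n')) as [_ (_ & _ & _ & [Hh|Hh])]; [|exact Hh].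
        destruct H. exists (Nat.max n n'). split; [lia|exact Hh].
      + exists Y. split; [easy|]. split; [easy|]. now right. }
  enough (good (fun _ => false) 0) as H.
  { destruct (H A HA) as (Y & H1 & H2 & H3); [now intros i|lia|]. now exists Y. }
  (* If the empty stem is bad, [Hbar] extends bad stems forever. Their limit is an infinite subset
     of [A], and continuity at the limit makes one of these stems good. *)
  apply NNPP. intros H.
  destruct (dependent_choice
    (fun i (u : nat * (nat -> bool)) => ~ good (snd u) (fst u) /\ i <= fst u /\
       subset (snd u) A /\ forall j, snd u j = true -> j < fst u)
    (fun _ u v => exists n, fst u <= n /\ fst v = S n /\ snd v = insert n (snd u))
    (0, fun _ => false)) as (f & Hf0 & Hf).
  { simpl. repeat split; easy. }
  { intros i [m F] (H1 & H2 & H3 & H4). simpl in *.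
    destruct (classic (forall n, m <= n -> A n = true -> good (insert n F) (S n))) as [Hn|Hn];
      [now destruct (H1 (Hbar F m Hn))|].
    apply not_all_ex_not in Hn. destruct Hn as [n Hn].
    apply imply_to_and in Hn. destruct Hn as [Hmn Hn]. apply imply_to_and in Hn.
    destruct Hn as [HAn Hn].
    exists (S n, insert n F). simpl. repeat split; [easy|lia| | |].
    - intros j Hj. unfold insert in Hj. apply orb_prop in Hj as [Hj|Hj]; [|auto].
      apply Nat.eqb_eq in Hj. now subst.
    - intros j Hj. unfold insert in Hj. apply orb_prop in Hj as [Hj|Hj].
      + apply Nat.eqb_eq in Hj. lia.
      + specialize (H4 j Hj). lia.
    - now exists n. }
  set (F := fun i => snd (f i)). set (m := fun i => fst (f i)).
  assert (forall i j l, i <= j -> l < m i -> F j l = F i l) as Hst.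
  { intros i j l Hij Hl. induction Hij as [|j Hij IH]; [easy|]. rewrite <- IH.
    destruct (Hf j) as [_ (n & H1 & _ & H2)]. unfold F. rewrite H2. unfold insert.
    destruct (Nat.eqb_spec l n) as [->|]; [|easy]. exfalso.
    enough (m i <= m j) by (unfold m in *; lia). clear - Hij Hf.
    induction Hij as [|j Hij IH]; [easy|]. destruct (Hf j) as [_ (n & H1 & H2 & _)].
    unfold m in *. lia. }
  assert (forall i, i <= m i) as Hm by (intros i; apply (Hf i)).
  (* Stage [S l] has settled [l], since [l < S l <= m (S l)]. *)
  set (Y := fun l => F (S l) l).
  assert (forall i, agree (m i) (F i) Y) as HFY.
  { intros i l Hl. unfold Y. destruct (Nat.le_gt_cases i (S l)) as [Hil|Hil].
    - symmetry. now apply Hst.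
    - apply Hst; [lia|]. specialize (Hm (S l)). lia. }
  assert (infinite Y) as HY.
  { intros i. destruct (Hf i) as [_ (n & H1 & H2 & H3)]. exists n.
    split; [specialize (Hm i); unfold m in Hm; lia|].
    rewrite <- (HFY (S i)) by (unfold m; lia). unfold F. rewrite H3. unfold insert.
    now rewrite Nat.eqb_refl. }
  assert (subset Y A) as HYA by (intros l Hl; now apply (Hf (S l))).
  (* The stem [F k] agrees with [Y] below [m k], hence below [k], so every infinite continuation
     inside [A] above [m k] has the colour of [Y]. *)
  destruct (Hcont Y HY HYA) as [k Hk]. apply (Hf k).
  intros X HX HXA HXm. exists X. split; [easy|]. split; [now intros i|].
  assert (forall S', infinite S' -> subset S' X -> (chi Y <-> chi (union (F k) S'))) as HS.
  { intros S' HS' HSX. apply Hk.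
    - apply (infinite_superset S'); [easy|]. intros i Hi. unfold union. now rewrite Hi, orb_true_r.
    - intros i Hi. unfold union in Hi. apply orb_prop in Hi as [Hi|Hi]; [|auto].
      now apply (Hf k).
    - intros i Hi. specialize (Hm k). rewrite <- (HFY k) by lia. unfold union.
      destruct (S' i) eqn:E; [|now rewrite orb_false_r].
      apply HSX, HXm in E. unfold m in Hm. lia. }
  destruct (classic (chi Y)) as [HcY|HcY]; [left|right]; intros S' HS1 HS2.
  - now apply (HS S').
  - intros Hc. apply HcY. now apply (HS S').
Qed.

(** * Construction of the subset *)

Section Construction.

Variable en : nat -> (nat -> bool) -> nat -> bool.
Variable piv : nat -> nat.
Hypothesis en_mono : forall j j' Y x, j <= j' -> en j Y x = true -> en j' Y x = true.
Hypothesis en_ext : forall j Y Z x, agree j Y Z -> en j Y x = en j Z x.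
Variable A : nat -> bool.
Hypothesis en_total : forall Y x, infinite Y -> subset Y A ->
  ((exists j, en j Y x = true) <-> A x = true).
Hypothesis piv_in : forall s, A s = true -> A (piv s) = true.

Notation selected := (selected en piv).

(** Makes the colouring of each stage clopen: a nonzero verdict depends only on the part of the set
    below [k]. *)
Lemma selected_continuous e Y :
  infinite Y -> subset Y A ->
  eventually (fun k => forall Z, agree k Y Z -> (selected (S e) Y e <-> selected (S e) Z e)).
Proof.
  intros HY HA.
  eapply eventually_imp;
    [|exact (selected_at_complete en piv en_mono en_ext A en_total piv_in e Y HY HA)].
  intros k Hk Z HZ. assert (Hext := selected_at_ext en piv k e Y Z HZ).
  rewrite !(selected_at_decides en piv en_mono en_ext k) by congruence. now rewrite Hext.
Qed.

(** In a stage [u], [fst u] is the part of the final set below [m] and [snd u] is the reservoir. *)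
Record stage (A0 : nat -> bool) (m : nat) (u : (nat -> bool) * (nat -> bool)) : Prop := {
  stage_infinite : infinite (snd u);
  stage_subset : subset (snd u) A0;
  stage_above : forall i, snd u i = true -> m <= i;
  stage_below : forall i, fst u i = true -> i < m;
  stage_in : subset (fst u) A;
  stage_selected : forall Y, infinite Y -> subset Y (snd u) ->
    forall i, selected m Y i <-> fst u i = true;
  stage_consistent : forall b, fst u b = true ->
    forall G, (forall g, G g = true -> b < g /\ fst u g = true) ->
    forall Y, infinite Y -> subset Y (snd u) ->
    forall a, a <= b -> (selected (S b) (union G Y) a <-> fst u a = true)
}.

(** A rejection is recorded for all infinite subsets of the new reservoir; the proof that the final
    set is infinite contradicts it there. *)
Definition stage_step (m : nat) (u v : (nat -> bool) * (nat -> bool)) : Prop :=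
  subset (snd v) (snd u) /\
  (fst v = insert m (fst u) \/
   fst v = fst u /\ forall Y, infinite Y -> subset Y (snd v) -> ~ selected (S m) Y m).

Lemma union_false_l Y : union (fun _ => false) Y = Y.
Proof. apply functional_extensionality. now intros i. Qed.

(** The colour is whether [m] is selected, and the new reservoir is homogeneous for it. If [m] joins
    the fixed part, the consistency clause in its selection is what preserves [stage_consistent]. *)
Lemma stage_extend A0 m u :
  subset A0 A -> stage A0 m u -> exists v, stage A0 (S m) v /\ stage_step m u v.
Proof.
  destruct u as [F X]. intros HA0 [HX HXA HXm HFm HFA Hsel Hcons]. simpl in *.
  assert (subset X A) as HXA' by now apply subset_trans with A0.
  destruct (clopen_ramsey (above m X) (fun Y => selected (S m) Y m)) as (X' & HX' & HXX' & Hhom).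
  { now apply infinite_above. }
  { intros Y HY HYX. destruct (selected_continuous m Y HY) as [k Hk].
    - intros i Hi. now apply HYX, subset_above, HXA' in Hi.
    - exists k. intros Z _ _ HYZ. now apply (Hk k). }
  assert (subset X' X) as HX'X by (apply subset_trans with (above m X); [easy|apply subset_above]).
  assert (forall i, X' i = true -> S m <= i) as HX'm.
  { intros i Hi. apply HXX' in Hi. unfold above in Hi. apply andb_prop in Hi.
    now apply Nat.ltb_lt. }
  assert (subset X' A0) as HX'A by now apply subset_trans with X.
  assert (forall Y, subset Y X' -> subset Y X) as Htr by (intros Y HY; now apply subset_trans with X').
  destruct Hhom as [Hhom|Hhom].
  - exists (insert m F, X'). split; [|split; [easy|now left]].
    assert (forall i, insert m F i = true <-> F i = true \/ i = m) as Hins.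
    { intros i. unfold insert. rewrite orb_true_iff, Nat.eqb_eq. tauto. }
    assert (accepted en piv m X') as Hacc.
    { assert (Hm := Hhom X' HX' (fun i Hi => Hi)). simpl in Hm.
      destruct Hm as [Hm|(_ & Hm & _)]; [|easy]. apply selected_lt in Hm. lia. }
    split; cbn [fst snd]; try easy.
    + intros i Hi. apply Hins in Hi. destruct Hi as [Hi| ->]; [apply HFm in Hi|]; lia.
    + intros i Hi. apply Hins in Hi. destruct Hi as [Hi| ->]; [auto|].
      apply (accepted_in en piv A en_total piv_in m X'); try easy. now apply subset_trans with X.
    + intros Y HY HYX i. simpl. rewrite Hins. rewrite (Hsel Y) by auto.
      assert (Hm := Hhom Y HY HYX). simpl in Hm.
      destruct Hm as [Hm|Hm]; [apply selected_lt in Hm; lia|].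
      split; [tauto|]. intros [Hi| ->]; tauto.
    + intros b Hb G HG Y HY HYX a Hab. rewrite Hins. apply Hins in Hb.
      assert (Hm := Hhom Y HY HYX). simpl in Hm.
      destruct Hm as [Hm|(_ & _ & Hm)]; [apply selected_lt in Hm; lia|].
      destruct Hb as [Hb| ->].
      * assert (b < m) as Hbm by auto.
        transitivity (F a = true); [|split; [tauto|intros [H| ->]; [easy|lia]]].
        (* If [G] contains [m], then [union G Y] is the rest of [G] joined to [insert m Y], as in
           the consistency clause for [m]. Otherwise the previous stage applies. *)
        destruct (G m) eqn:EG.
        -- set (G' := fun g => G g && negb (g =? m)).
           assert (union G Y = union G' (insert m Y)) as ->.
           { apply functional_extensionality. intros i. unfold union, insert, G'.
             destruct (Nat.eqb_spec i m) as [->|]; simpl; [now rewrite EG, orb_true_r|].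
             now rewrite andb_true_r. }
           rewrite <- (selected_stable en piv (S b) m) by lia.
           rewrite <- (Hsel Y) by auto. apply Hm with b; [now apply Hsel; auto| |easy].
           intros g Hg. unfold G' in Hg. apply andb_prop in Hg. destruct Hg as [Hg1 Hg2].
           destruct (HG g Hg1) as [H1 H2]. split; [easy|]. apply Hsel; auto.
           apply Hins in H2. destruct H2 as [H2| ->]; [easy|]. now rewrite Nat.eqb_refl in Hg2.
        -- apply Hcons; auto. intros g Hg. destruct (HG g Hg) as [H1 H2]. split; [easy|].
           apply Hins in H2. destruct H2 as [H2| ->]; [easy|congruence].
      (* Nothing in [insert m F] lies above [b = m]. *)
      * assert (G = fun _ => false) as ->.
        { apply functional_extensionality. intros g. destruct (G g) eqn:E; [|easy].
          destruct (HG g E) as [H1 H2]. apply Hins in H2. destruct H2 as [H2| ->]; [|lia].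
          apply HFm in H2. lia. }
        rewrite union_false_l. assert (Hm' := Hhom Y HY HYX). simpl in Hm'.
        simpl. rewrite (Hsel Y) by auto. split; [tauto|]. intros [H| ->]; [tauto|].
        destruct Hm' as [Hm'|Hm']; [apply selected_lt in Hm'; lia|tauto].
  - exists (F, X'). split; [|split; [easy|now right]].
    split; cbn [fst snd]; try easy.
    + intros i Hi. apply HFm in Hi. lia.
    + intros Y HY HYX i. simpl. rewrite (Hsel Y) by auto. split; [|tauto]. intros [H|[-> H]]; [easy|].
      destruct (Hhom Y HY HYX). simpl. tauto.
    + intros b Hb G HG Y HY HYX. apply Hcons; auto.
Qed.

Lemma selecting_set A0 :
  infinite A0 -> subset A0 A ->
  (forall c Y, A0 c = true -> infinite Y -> subset Y A0 ->
     (forall i, Y i = true -> c < i) -> accepted en piv c Y) ->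
  exists B, infinite B /\ subset B A /\
    forall Y s, infinite Y -> subset Y B -> Y s = true ->
    forall a, a <= s -> (selected (S a) (above s Y) a <-> B a = true).
Proof.
  intros HA0 HA0A Hacc.
  destruct (dependent_choice (stage A0) stage_step (fun _ => false, A0)) as (f & _ & Hf).
  { split; cbn [fst snd]; try easy. intros i. lia. }
  { intros m u Hu. now apply stage_extend. }
  set (F := fun m => fst (f m)). set (X := fun m => snd (f m)).
  assert (forall m, stage A0 m (f m)) as Hst by apply Hf.
  assert (forall m m', m <= m' -> subset (X m') (X m)) as HX.
  { intros m m' Hm. induction Hm as [|m' Hm IH]; [easy|].
    apply subset_trans with (X m'); [apply Hf|easy]. }
  assert (forall m m' i, m <= m' -> i < m -> F m' i = F m i) as HF.
  { intros m m' i Hm Hi. induction Hm as [|m' Hm IH]; [easy|]. rewrite <- IH.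
    destruct (Hf m') as [_ [_ [H|[H _]]]]; unfold F; rewrite H; [|easy].
    unfold insert. destruct (Nat.eqb_spec i m'); [lia|easy]. }
  set (B := fun i => F (S i) i).
  assert (forall m i, i < m -> F m i = B i) as HFB by (intros m i Hi; apply HF; lia).
  assert (forall m i, F m i = true -> B i = true) as HFB'.
  { intros m i Hi. rewrite <- (HFB m); [easy|]. now apply (stage_below _ _ _ (Hst m)). }
  assert (subset B A) as HBA by (intros i Hi; now apply (stage_in _ _ _ (Hst (S i)))).
  exists B. split; [|split; [easy|]].
  (* If nothing from [m] on is kept, an element [c] of the reservoir [X m] is rejected at stage [c],
     yet it passes the test on [X (S c)]. *)
  - intros m. apply NNPP. intros Hno.
    assert (forall i, m <= i -> F i = F m) as HFm.
    { intros i Hi. apply functional_extensionality. intros j.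
      destruct (Nat.lt_ge_cases j m) as [Hj|Hj]; [now apply HF|].
      assert (forall i', F i' j = false) as HFj.
      { intros i'. destruct (F i' j) eqn:E; [|easy]. destruct Hno. exists j. eauto. }
      now rewrite !HFj. }
    destruct (stage_infinite _ _ _ (Hst m) 0) as (c & _ & Hc).
    assert (Hmc := stage_above _ _ _ (Hst m) c Hc).
    destruct (Hf c) as [_ [_ [H|[_ H]]]].
    { assert (E := HFm (S c) ltac:(lia)). rewrite <- (HFm c Hmc) in E. unfold F in E.
      rewrite H in E. apply (f_equal (fun g => g c)) in E. unfold insert in E.
      rewrite Nat.eqb_refl in E. symmetry in E. apply (stage_below _ _ _ (Hst c)) in E. lia. }
    assert (HXi := stage_infinite _ _ _ (Hst (S c))).
    apply (H _ HXi (fun i Hi => Hi)). simpl. right. split; [easy|].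
    fold (X (S c)) in *.
    assert (forall i, selected c (X (S c)) i <-> F m i = true) as Hsel.
    { intros i. rewrite <- (HFm c Hmc). apply (stage_selected _ _ _ (Hst c)); [easy|].
      apply HX. lia. }
    split.
    + apply Hacc; [now apply (stage_subset _ _ _ (Hst m))|easy|apply (stage_subset _ _ _ (Hst (S c)))|].
      intros i Hi. apply (stage_above _ _ _ (Hst (S c))) in Hi. lia.
    + intros b Hb G HG a Hab. rewrite Hsel in *.
      assert (b < m) as Hbm by now apply (stage_below _ _ _ (Hst m)).
      rewrite (selected_stable en piv (S b)) by lia.
      (* Since [c] was taken from [X m], the set [insert c (X (S c))] still lies in [X m]. *)
      apply (stage_consistent _ _ _ (Hst m)); try easy.
      * intros g Hg. destruct (HG g Hg) as [H1 H2]. split; [easy|now apply Hsel].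
      * apply (infinite_superset (X (S c))); [easy|]. intros i Hi. unfold insert.
        now rewrite Hi, orb_true_r.
      * intros i Hi. unfold insert in Hi. apply orb_prop in Hi as [Hi|Hi].
        -- apply Nat.eqb_eq in Hi. now subst.
        -- apply (HX m (S c)); [lia|easy].
  - intros Y s HY HYB Hs a Has.
    destruct (selected_continuous a (above s Y)) as [k Hk].
    { now apply infinite_above. }
    { intros i Hi. now apply subset_above, HYB, HBA in Hi. }
    (* Members of [Y] from [m] on need not lie in [X m]. As [m] is at least [k], replacing them by
       [X m] does not change whether [a] is selected. The remaining part [G] consists of members of
       [F m] above [s], so [stage_consistent] applies with [b = s]. *)
    set (m := Nat.max k (S s)). specialize (Hk k (le_n k)).
    set (G := fun i => above s Y i && (i <? m)).
    rewrite (Hk (union G (X m))).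
    + assert (B s = true) as HBs by auto.
      rewrite <- (HFB m) in HBs by lia. rewrite <- (HFB m a) by lia.
      rewrite <- (selected_stable en piv (S a) (S s)) by lia.
      apply (stage_consistent _ _ _ (Hst m)); try easy; [|apply Hst].
      intros g Hg. unfold G in Hg. apply andb_prop in Hg. destruct Hg as [H1 H2].
      apply Nat.ltb_lt in H2. unfold above in H1. apply andb_prop in H1. destruct H1 as [H1 H3].
      split; [now apply Nat.ltb_lt|]. change (F m g = true). rewrite HFB by easy. auto.
    + intros i Hi. unfold union, G. rewrite (proj2 (Nat.ltb_lt i m)) by lia.
      rewrite andb_true_r. destruct (X m i) eqn:E; [|now rewrite orb_false_r].
      apply (stage_above _ _ _ (Hst m)) in E. lia.
Qed.

End Construction.

(** * The pivot and the functional *)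

(** Stage [j] bounds the prefix length as well as the searches, so it reads [Y] only below [j]. *)
Definition enumerated (p : prog) (j : nat) (Y : nat -> bool) (x : nat) : bool :=
  bex (S j) (fun len => bex (S j) (fun t => 0 <? bounded_eval t p [prefix_code len Y; x])).

Lemma enumerated_mono p j j' Y x :
  j <= j' -> enumerated p j Y x = true -> enumerated p j' Y x = true.
Proof.
  intros Hj H. unfold enumerated in *. apply bex_spec in H. destruct H as (len & Hlen & H).
  apply bex_spec in H. destruct H as (t & Ht & H). apply bex_spec. exists len. split; [lia|].
  apply bex_spec. exists t. split; [lia|easy].
Qed.

Lemma enumerated_ext p j Y Z x : agree j Y Z -> enumerated p j Y x = enumerated p j Z x.
Proof.
  intros H. apply bex_ext. intros len Hlen.
  now rewrite (prefix_code_ext len Y Z) by (apply agree_le with j; [lia|easy]).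
Qed.

Lemma enumerated_spec Theta p Y x :
  (forall sigma x, Theta sigma x <-> exists y, eval (fun _ => false) p [code sigma; x] y) ->
  ((exists j, enumerated p j Y x = true) <-> apply_op Theta Y x).
Proof.
  intros Hp. split.
  - intros [j Hj]. unfold enumerated in Hj. apply bex_spec in Hj. destruct Hj as (len & _ & Hj).
    apply bex_spec in Hj. destruct Hj as (t & _ & Ht). apply Nat.ltb_lt in Ht.
    exists (map Y (seq 0 len)). split.
    + intros i Hi. rewrite length_map, length_seq in Hi.
      rewrite nth_indep with (d' := Y 0) by now rewrite length_map, length_seq.
      now rewrite map_nth, seq_nth.
    + apply Hp. rewrite <- prefix_code_spec.
      destruct (bounded_eval t p [prefix_code len Y; x]) as [|y] eqn:E; [lia|].
      exists y. now apply bounded_eval_sound with t.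
  - intros (sigma & Hpre & Hs). apply Hp in Hs. destruct Hs as [y Hy].
    assert (sigma = map Y (seq 0 (length sigma))) as E.
    { apply nth_ext with false (Y 0); [now rewrite length_map, length_seq|]. intros i Hi.
      rewrite map_nth, seq_nth by easy. now apply Hpre. }
    rewrite E, <- prefix_code_spec in Hy. apply bounded_eval_complete in Hy.
    destruct Hy as [t Ht]. exists (Nat.max (length sigma) t). apply bex_spec.
    exists (length sigma). split; [lia|]. apply bex_spec. exists t. split; [lia|].
    now rewrite Ht.
Qed.

Lemma pivot_exists en A :
  (forall j j' Y x, j <= j' -> en j Y x = true -> en j' Y x = true) ->
  (forall j Y Z x, agree j Y Z -> en j Y x = en j Z x) ->
  (forall Y x, infinite Y -> subset Y A -> ((exists j, en j Y x = true) <-> A x = true)) ->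
  infinite A ->
  exists piv A0,
    computable 1 (fun X l => piv (nth 0 l 0)) /\
    (forall s, A s = true -> A (piv s) = true) /\
    infinite A0 /\ subset A0 A /\
    forall c Y, A0 c = true -> infinite Y -> subset Y A0 ->
      (forall i, Y i = true -> c < i) -> accepted en piv c Y.
Proof.
  intros Hmono Hext Htotal HA.
  set (chi := fun Y => forall a b, least Y a -> least (above a Y) b ->
    forall j, en j (above b Y) b = true -> en j (above b Y) a = true).
  destruct (clopen_ramsey A chi HA) as (X & HX & HXA & Hhom).
  { intros Y HY HYA. destruct (HY 0) as (a' & _ & Ha'). destruct (least_exists Y a' Ha') as [a Ha].
    destruct (infinite_above a Y HY 0) as (b' & _ & Hb').
    destruct (least_exists _ b' Hb') as [b Hb].
    destruct (proj2 (Htotal (above b Y) b (infinite_above b Y HY)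
      (fun i Hi => HYA i (subset_above b Y i Hi)))) as [j0 Hj0].
    { apply HYA, (subset_above a), Hb. }
    (* Once [b] is enumerated, at stage [j0], only stages up to [j0] matter; this makes the colour
       clopen. *)
    assert (forall Z, least Z a -> least (above a Z) b -> en j0 (above b Z) b = true ->
      (chi Z <-> forall j, j <= j0 -> en j (above b Z) b = true -> en j (above b Z) a = true)) as Hchi.
    { intros Z HZa HZb HZj. split; [intros H j _; now apply H|]. intros H a1 b1 Ha1 Hb1 j Hj.
      rewrite (least_unique Z a1 a) in * by easy.
      rewrite (least_unique (above a Z) b1 b) in * by easy.
      destruct (Nat.le_gt_cases j j0) as [|Hjj]; [auto|]. apply Hmono with j0; [lia|auto]. }
    assert (forall s k W W', s < k -> agree k W W' -> least W s -> least W' s) as Hleast.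
    { intros s k W W' Hs HW [H1 H2]. split; [now rewrite <- HW|].
      intros i Hi. rewrite <- HW by lia. auto. }
    assert (a < b) as Hab.
    { destruct Hb as [Hb _]. unfold above in Hb. apply andb_prop in Hb. now apply Nat.ltb_lt. }
    exists (Nat.max (S b) j0). intros Z _ _ HYZ.
    assert (forall j x, j <= j0 -> en j (above b Z) x = en j (above b Y) x) as E.
    { intros j x Hj. symmetry. apply Hext, agree_above.
      apply agree_le with (Nat.max (S b) j0); [lia|easy]. }
    rewrite (Hchi Y), (Hchi Z); try easy.
    - split; intros H j Hj.
      + rewrite !E by easy. auto.
      + rewrite <- !E by easy. auto.
    - apply Hleast with (Nat.max (S b) j0) Y; [lia|easy|easy].
    - apply Hleast with (Nat.max (S b) j0) (above a Y); [lia|now apply agree_above|easy].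
    - now rewrite E. }
  destruct Hhom as [Hhom|Hhom].
  (* Positive colour: it is applied to [insert c Y], whose two least elements are [c] and [s]. *)
  - exists (fun s => s), X. split; [comp|]. repeat split; try easy.
    intros c Y Hc HY HYX Hcy. destruct (HY 0) as (s' & _ & Hs').
    destruct (least_exists Y s' Hs') as [s Hs]. exists s. split; [easy|]. intros j.
    assert (above c (insert c Y) = Y) as E1.
    { apply functional_extensionality. intros i. unfold above, insert.
      destruct (Nat.ltb_spec c i); destruct (Nat.eqb_spec i c); simpl; try easy; try lia.
      - destruct (Y i) eqn:E; [|easy]. apply Hcy in E. lia.
      - destruct (Y i) eqn:E; [|easy]. apply Hcy in E. lia. }
    assert (above s (insert c Y) = above s Y) as E2.
    { apply functional_extensionality. intros i. unfold above, insert.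
      destruct (Nat.ltb_spec s i); destruct (Nat.eqb_spec i c); simpl; try easy.
      destruct Hs as [Hs _]. apply Hcy in Hs. lia. }
    assert (chi (insert c Y)) as H.
    { apply Hhom.
      - apply (infinite_superset Y); [easy|]. intros i Hi. unfold insert. now rewrite Hi, orb_true_r.
      - intros i Hi. unfold insert in Hi. apply orb_prop in Hi as [Hi|Hi]; [|auto].
        apply Nat.eqb_eq in Hi. now subst. }
    rewrite <- E2. apply H; [|now rewrite E1]. unfold insert. split; [now rewrite Nat.eqb_refl|].
    intros i Hi. destruct (Nat.eqb_spec i c); [lia|]. simpl.
    destruct (Y i) eqn:E; [|easy]. apply Hcy in E. lia.
  (* Negative colour: the pivot is the minimum [a] of [X], and the colour is applied to [a] and [c]
     followed by [above s Y]. *)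
  - destruct (HX 0) as (a' & _ & Ha'). destruct (least_exists X a' Ha') as [a Ha].
    exists (fun _ => a), (above a X). split; [comp|].
    split; [intros _ _; apply HXA, Ha|]. split; [now apply infinite_above|].
    split; [apply subset_trans with X; [apply subset_above|easy]|].
    intros c Y Hc HY HYX Hcy. destruct (HY 0) as (s' & _ & Hs').
    destruct (least_exists Y s' Hs') as [s Hs]. exists s. split; [easy|]. intros j Hj.
    assert (a < c) as Hac.
    { unfold above in Hc. apply andb_prop in Hc. now apply Nat.ltb_lt. }
    assert (c < s) as Hcs by (apply Hcy, Hs).
    set (Z := insert a (insert c (above s Y))).
    assert (above c Z = above s Y) as E1.
    { apply functional_extensionality. intros i. unfold Z, insert, above.
      destruct (Nat.eqb_spec i a), (Nat.eqb_spec i c), (Nat.ltb_spec c i), (Nat.ltb_spec s i);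
        simpl; try easy; lia. }
    assert (~ chi Z) as H.
    { apply Hhom.
      - apply (infinite_superset (above s Y)); [now apply infinite_above|].
        intros i Hi. unfold Z, insert. now rewrite Hi, !orb_true_r.
      - intros i Hi. unfold Z, insert in Hi. apply orb_prop in Hi as [Hi|Hi].
        + apply Nat.eqb_eq in Hi. subst. apply Ha.
        + apply (subset_above a). apply orb_prop in Hi as [Hi|Hi].
          * apply Nat.eqb_eq in Hi. now subst.
          * now apply subset_above, HYX in Hi. }
    assert (least Z a) as HZa.
    { unfold Z, insert, above. split; [now rewrite Nat.eqb_refl|]. intros i Hi.
      destruct (Nat.eqb_spec i a), (Nat.eqb_spec i c), (Nat.ltb_spec s i); simpl; try easy; lia. }
    assert (least (above a Z) c) as HZc.
    { unfold least, Z, insert, above. split.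
      - now rewrite (proj2 (Nat.ltb_lt a c)), Nat.eqb_refl, orb_true_r by easy.
      - intros i Hi.
        destruct (Nat.ltb_spec a i), (Nat.eqb_spec i a), (Nat.eqb_spec i c), (Nat.ltb_spec s i);
          simpl; try easy; lia. }
    (* If [c] were missing at stage [j], any stage containing [c] would be later and would also
       contain [a], which gives [Z] the excluded colour. *)
    destruct (en j (above s Y) c) eqn:E; [easy|]. destruct H.
    intros a1 b1 H1 H2. rewrite (least_unique Z a1 a) in * by easy.
    rewrite (least_unique (above a Z) b1 c) by easy. rewrite E1. intros j' Hj'.
    destruct (Nat.le_gt_cases j' j) as [Hjj|Hjj].
    + rewrite (Hmono j' j _ c Hjj Hj') in E. discriminate.
    + apply Hmono with j; [lia|easy].
Qed.

(** The set enters as a numeral because the recursion of [rule_course] handles finite sets as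
    numbers. *)
Lemma computable_enumerated p :
  computable 4 (fun X l => Nat.b2n
    (enumerated p (nth 0 l 0) (above (nth 2 l 0) (Nat.testbit (nth 1 l 0))) (nth 3 l 0))).
Proof.
  unfold enumerated. apply computable_bex; [comp|]. apply computable_bex; [comp|].
  apply computable_ltb; [comp|].
  apply (computable_comp _ _ _
    (fun X l => [nth 0 l 0; prefix_code (nth 0 (tl l) 0)
      (above (nth 2 (tl (tl l)) 0) (Nat.testbit (nth 1 (tl (tl l)) 0))); nth 3 (tl (tl l)) 0])
    (computable_bounded_eval p 2)).
  comp_list. unfold prefix_code, above. comp.
Qed.

(** * Computability of the approximations *)

Section Program.

Variable en : nat -> (nat -> bool) -> nat -> bool.
Variable piv : nat -> nat.
Hypothesis en_computable : computable 4 (fun X l => Nat.b2n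
  (en (nth 0 l 0) (above (nth 2 l 0) (Nat.testbit (nth 1 l 0))) (nth 3 l 0))).
Hypothesis piv_computable : computable 1 (fun X l => piv (nth 0 l 0)).

Lemma computable_en k j D s x :
  computable k j -> computable k D -> computable k s -> computable k x ->
  computable k (fun X l => Nat.b2n (en (j X l) (above (s X l) (Nat.testbit (D X l))) (x X l))).
Proof.
  apply (computable_comp4 k (fun j D s x => Nat.b2n (en j (above s (Nat.testbit D)) x))
    j D s x en_computable).
Qed.

Lemma computable_accepted_at k r c D :
  computable k r -> computable k c -> computable k D ->
  computable k (fun X l => accepted_at en piv (r X l) (c X l) (Nat.testbit (D X l))).
Proof.
  apply (computable_comp3 k (fun r c D => accepted_at en piv r c (Nat.testbit D))).
  unfold accepted_at, leastb.
  assert (forall k s, computable k s -> computable k (fun X l => piv (s X l))) as Hpiv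
    by (intros; now apply computable_comp1).
  repeat first [progress comp_bool | lazymatch goal with
    | |- computable _ (fun _ _ => Nat.b2n (en _ _ _)) => apply computable_en
    | |- computable _ (fun _ _ => piv _) => apply Hpiv
    end].
Qed.

Lemma computable_mask k r D :
  computable k r -> computable (S k) (fun X l => Nat.b2n (D X (tl l) (nth 0 l 0))) ->
  computable k (fun X l => mask (r X l) (D X l)).
Proof. intros Hr HD. unfold mask. comp. Qed.

Lemma computable_digit k T i :
  computable k T -> computable k i -> computable k (fun X l => digit (T X l) (i X l)).
Proof. intros HT Hi. unfold digit. comp. Qed.

Lemma computable_rule_course :
  computable 3 (fun X l => rule_course en piv (nth 0 l 0) (nth 1 l 0) (nth 2 l 0)).
Proof.
  unfold rule_course, rule, union, insert.
  repeat first [progress comp_bool | lazymatch goal with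
    | |- computable _ (fun _ _ => accepted_at _ _ _ _ _) => apply computable_accepted_at
    | |- computable _ (fun _ _ => digit _ _) => apply computable_digit
    | |- computable _ (fun _ _ => mask _ _) => apply computable_mask
    end].
Qed.

(** The approximation reads the oracle only to form the mask of [above s X] below [k]; the rest is
    arithmetic. *)
Lemma computable_selected_at :
  computable 3 (fun X l => selected_at en piv (nth 0 l 0) (nth 2 l 0) (above (nth 1 l 0) X)).
Proof.
  unfold selected_at. apply (computable_comp2 3 (course (rule_course en piv))).
  - apply computable_course, computable_rule_course.
  - comp.
  - comp. unfold above. apply computable_mask; comp. apply computable_oracle. comp.
Qed.

End Program.

(** The search halts only where a zero exists, so the result is conditional and not an instance of
    [computable]. *)
Lemma computable_search k f :
  computable (S k) f ->
  exists p, forall X l, length l = k -> (exists y, f X (y :: l) = 0) ->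
    exists y, f X (y :: l) = 0 /\ eval X p l y.
Proof.
  intros [p Hp]. exists (PMu p). intros X l Hl [y Hy].
  assert (forall z, eval X p (z :: l) (f X (z :: l))) as Hz by (intros z; apply Hp; simpl; lia).
  destruct (least_exists (fun z => f X (z :: l) =? 0) y) as (z & H1 & H2);
    [now apply Nat.eqb_eq|].
  apply Nat.eqb_eq in H1. exists z. split; [easy|]. constructor.
  - now rewrite <- H1.
  - intros z' Hz'. apply H2, Nat.eqb_neq in Hz'. exists (pred (f X (z' :: l))).
    now rewrite Nat.succ_pred.
Qed.

Theorem theorem1p4 (A : nat -> bool) :
  infinite A ->
  (exists Theta : list bool -> nat -> Prop,
      ce_pairs Theta /\
      forall S : nat -> bool, infinite S -> subset S A ->
        forall x, apply_op Theta S x <-> A x = true) ->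
  exists (B : nat -> bool) (Phi : prog),
    infinite B /\ subset B A /\
    forall S : nat -> bool, infinite S -> subset S B -> computes Phi S B.
Proof.
  intros HA (Theta & [p Hp] & HTheta).
  assert (forall Y x, infinite Y -> subset Y A ->
    ((exists j, enumerated p j Y x = true) <-> A x = true)) as Htotal.
  { intros Y x HY HYA. rewrite (enumerated_spec Theta) by easy. auto. }
  assert (Hmono := enumerated_mono p). assert (Hext := enumerated_ext p).
  assert (Hen := computable_enumerated p).
  set (en := enumerated p) in *. clearbody en. clear Hp HTheta.
  destruct (pivot_exists en A Hmono Hext Htotal HA)
    as (piv & A0 & Hpiv & HpivA & HA0 & HA0A & Hacc).
  destruct (selecting_set en piv Hmono Hext A Htotal HpivA A0 HA0 HA0A Hacc)
    as (B & HB & HBA & Hsel).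
  (* [p1] finds [i] with [i + n] in the oracle, that is, an element [s] at or above [n]. *)
  destruct (computable_search 1 (fun X l => 1 - Nat.b2n (X (nth 0 l 0 + nth 1 l 0))))
    as [p1 Hp1].
  { comp. apply computable_oracle. comp. }
  (* [p2] finds a bound [k] at which [n] is decided: the difference vanishes exactly for nonzero
     verdicts. *)
  destruct (computable_search 2 (fun X l =>
    1 - selected_at en piv (nth 0 l 0) (nth 2 l 0) (above (nth 1 l 0) X))) as [p2 Hp2].
  { comp. now apply computable_selected_at. }
  (* The predecessor turns the verdicts 1 and 2 into the output bits 0 and 1. *)
  destruct (computable_pred 3 _ (computable_selected_at en piv Hen Hpiv)) as [p3 Hp3].
  destruct (computable_add 2 (fun X l => nth 0 l 0) (fun X l => nth 1 l 0)
    (computable_nth 2 0) (computable_nth 2 1)) as [padd Hadd].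
  exists B, (PComp (PComp p3 [p2; PProj 0; PProj 1]) [PComp padd [p1; PProj 0]; PProj 0]).
  split; [easy|]. split; [easy|]. intros Y HY HYB n.
  destruct (Hp1 Y [n] eq_refl) as (i & Hi & Hi').
  { destruct (HY n) as (s & Hns & Hs). exists (s - n). simpl.
    replace (s - n + n) with s by lia. now rewrite Hs. }
  simpl in Hi. assert (Y (i + n) = true) as Hs by (destruct (Y (i + n)); [easy|simpl in Hi; lia]).
  set (s := i + n) in *.
  assert (infinite (above s Y)) as HYs by now apply infinite_above.
  assert (subset (above s Y) A) as HYA by (intros l Hl; now apply subset_above, HYB, HBA in Hl).
  destruct (Hp2 Y [s; n] eq_refl) as (k & Hk & Hk').
  { destruct (selected_at_complete en piv Hmono Hext A Htotal HpivA n (above s Y) HYs HYA) as [k Hk].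
    exists k. specialize (Hk k (le_n k)). cbn [nth]. lia. }
  cbn [nth] in Hk. assert (selected_at en piv k n (above s Y) <> 0) as Hn by lia.
  assert (Hd := selected_at_decides en piv Hmono Hext k n (above s Y) Hn).
  rewrite (Hsel Y s HY HYB Hs n) in Hd by lia.
  assert (Hle := selected_at_le en piv Hext k n (above s Y)).
  replace (if B n then 1 else 0) with (pred (selected_at en piv k n (above s Y))).
  2: { destruct (B n); [rewrite (proj1 Hd); easy|].
       destruct (selected_at en piv k n (above s Y)) as [|[|[|]]]; try easy; lia. }
  apply eComp with [s; n].
  - constructor; [|constructor; [apply (eProj Y 0 [n])|constructor]].
    apply eComp with [i; n]; [|exact (Hadd Y [i; n] eq_refl)].
    constructor; [easy|constructor; [apply (eProj Y 0 [n])|constructor]].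
  - apply eComp with [k; s; n]; [|exact (Hp3 Y [k; s; n] eq_refl)].
    constructor; [easy|]. constructor; [apply (eProj Y 0 [s; n])|].
    constructor; [apply (eProj Y 1 [s; n])|constructor].
Qed.
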